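(* Suppose that the following hold. (K-a) For every compact subset $Z_0\subset Z$ with projection $X_0$ on $X$, for every $\epsilon>0$ there is $\eta>0$ such that $\|k(\cdot,x')-k(\cdot,x)\|_k<\epsilon$ for all $x,x'\in X_0$ with $\|x'-x\|<\eta$. (K-b) There is a constant $\beta>0$ such that $\|f\|_k\le\beta$ for all $f\in\mathcal F$. (C-a) There is a gauge function $\phi:Z\to[0,\infty)$ such that $c(z,f(x))\le\phi(z)$ for all $z=(x,y)\in Z$ and $f\in\mathcal F$, and $\phi(z)\to\infty$ as $\|z\|\to\infty$. (C-b) $c:Z\times Y\to\mathbb R$ is continuous. Let $\kappa\ge 0$, $p>1$, and let $\mathcal M_{Z,\kappa}^{\phi^p}$ be the class of all $P\in\mathscr P(Z)$ with $\int_Z\phi(z)^p\,P(dz)\le\kappa$. Let $\mathcal M\subset\mathcal M_{Z,\kappa}^{\phi^p}$, and let $\{\lambda_N\}$ be a sequence of positive numbers with $\lambda_N\to 0$ as $N\to\infty$. Then for every $P\in\mathcal M$ and every $\epsilon>0$ there exist $\delta>0$ and $N_0\in\mathbb N$ such that for every $Q\in\mathcal M$ with $\mathsf d_\phi(P,Q)\le\delta$, $$\mathsf d_{\mathrm{Prok}}\left(P^{\otimes N}\circ\hat\vartheta_N(\cdot,\lambda_N)^{-1},\;Q^{\otimes N}\circ\hat\vartheta_N(\cdot,\lambda_N)^{-1}\right)\le\epsilon$$ for all $N\ge N_0$ with $\lambda_N\le\frac{\epsilon}{6\beta^2}$.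
   Context: Setting. $X$ is the input space and $Y\subseteq\mathbb R$ the output space; $X$ and $Z:=X\times Y$ are subsets of normed spaces, with norms denoted $\|\cdot\|$, and $Z$ is Polish; elements of $Z$ are written $z=(x,y)$. $\mathscr P(Z)$ is the set of Borel probability measures on $Z$. $k:X\times X\to\mathbb R$ is a given positive definite symmetric kernel (all matrices $[k(x_i,x_j)]_{ij}$ are symmetric positive semidefinite), $\mathcal H_k$ is its reproducing kernel Hilbert space (so $k(\cdot,x)\in\mathcal H_k$ and $f(x)=\langle f,k(\cdot,x)\rangle$ for $f\in\mathcal H_k$, $x\in X$), with norm $\|\cdot\|_k$. $\mathcal F$ is a (nonempty) subset of $\mathcal H_k$ of functions $X\to Y$. The cost function $c:Z\times Y\to\mathbb R$ is such that $c(z,f(x))\ge 0$. A gauge function is a continuous $\phi:Z\to[0,\infty)$ with $\phi\ge 1$ outside a compact set. Regularized empirical risk: for a sample $\vec z^N=(z^1,\dots,z^N)\in Z^{\otimes N}$ (the $N$-fold Cartesian product), $z^i=(x^i,y^i)$, and $\lambda_N>0$, $$\hat\vartheta_N(\vec z^N,\lambda_N):=\inf_{f\in\mathcal F}\Big\{\frac1N\sum_{i=1}^N c(z^i,f(x^i))+\lambda_N\|f\|_k^2\Big\}.$$ $P^{\otimes N}$ is the product measure on $Z^{\otimes N}$ with marginals $P$ (i.i.d. samples), and $P^{\otimes N}\circ\hat\vartheta_N(\cdot,\lambda_N)^{-1}$ is the law on $\mathbb R$ of $\hat\vartheta_N(\cdot,\lambda_N)$ under $P^{\otimes N}$. Prokhorov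 metric (on probability measures on $Z$ or on $\mathbb R$): $\mathsf d_{\mathrm{Prok}}(P',P''):=\inf\{\epsilon>0: P'(A)\le P''(A^\epsilon)+\epsilon\text{ for all Borel }A\}$, where $A^\epsilon$ is the set of points at distance less than $\epsilon$ from some point of $A$. For $P',P''$ with $\int_Z\phi\,dP',\int_Z\phi\,dP''<\infty$, $\mathsf d_\phi(P',P''):=\mathsf d_{\mathrm{Prok}}(P',P'')+\left|\int_Z\phi\,dP'-\int_Z\phi\,dP''\right|$.
   Formalization: ''Z is Polish'' is taken to mean that Z is separable and complete in the metric of its norm (so Y is closed); if Z is only completely metrizable, e.g. Y=(0,1) with c=1+sin(x/y'), the claim fails. *)

(* Defs.v *)
From HB Require Import structures.
From mathcomp Require Import all_boot all_order all_algebra.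
From mathcomp Require Import all_classical all_reals all_analysis.

Set Implicit Arguments.
Unset Strict Implicit.
Unset Printing Implicit Defensive.

Import Order.TTheory GRing.Theory Num.Theory.
Import numFieldNormedType.Exports.

Local Open Scope classical_set_scope.
Local Open Scope ring_scope.

(* A topological space with its Borel sigma-algebra. Measurable types are
   pointed in the library, hence the base point [t0]; neither the topology nor
   the sigma-algebra depends on it. *)
Definition borel_space (T : topologicalType) (t0 : T) : Type := T.

HB.instance Definition _ (T : topologicalType) (t0 : T) :=
  Topological.copy (borel_space t0) T.
HB.instance Definition _ (T : topologicalType) (t0 : T) :=
  isPointed.Build (borel_space t0) t0.
HB.instance Definition _ (T : topologicalType) (t0 : T) :=
  @isMeasurable.Build (sigma_display (@open T)) (borel_space t0)
    <<s @open T >> (@sigma_algebra0 _ setT open)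
    (@sigma_algebraC (borel_space t0) open)
    (@sigma_algebra_bigcup _ setT open).

(* Complete separable metric space; [dist] is meant to be a metric inducing the
   topology of [T]. Completeness is for [dist] itself: with [T] merely
   completely metrizable, the output space could be (0,1), on which a continuous
   cost need not be uniformly continuous. *)
Definition polish (R : realType) (T : topologicalType)
    (dist : T -> T -> R) : Prop :=
  (exists2 D : set T, countable D & dense D) /\
  forall u : nat -> T,
    (forall e, 0 < e -> exists n0, forall m n,
       (n0 <= m)%N -> (n0 <= n)%N -> dist (u m) (u n) < e) ->
    exists l : T, u @ \oo --> l.

(* The norm on the space containing [X * Y] is not tied to the maximum norm of
   the library; it is any norm that induces the product topology. *)
Record product_norm (R : realType) (E : normedModType R)
    (nrm : E * R^o -> R) : Prop := ProductNorm {
  product_norm_eq0 : forall v, nrm v = 0 -> v = 0 ;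
  product_normZ : forall (a : R) v, nrm (a *: v) = `|a| * nrm v ;
  product_normD : forall v w, nrm (v + w) <= nrm v + nrm w ;
  product_norm_nbhs : forall A : set (E * R^o),
    nbhs (0 : E * R^o) A <-> exists2 e, 0 < e & [set v | nrm v < e] `<=` A }.

Definition embed (R : realType) (E : normedModType R) (X : set E) (Y : set R)
    (z : X * Y) : E * R^o := (\val z.1, \val z.2).

Definition embed_dist (R : realType) (E : normedModType R) (X : set E)
    (Y : set R) (nrm : E * R^o -> R) (z z' : X * Y) : R :=
  nrm (embed z - embed z').

Definition kernel_psd (R : realType) (X : Type) (k : X -> X -> R) : Prop :=
  (forall x y, k x y = k y x) /\
  forall (n : nat) (x : 'I_n -> X) (a : 'I_n -> R),
    0 <= \sum_i \sum_j a i * a j * k (x i) (x j).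

(* The axioms determine the set and, on it, the inner product
   (Moore-Aronszajn); values of [rkhs_dot] outside [rkhs_set] are
   irrelevant. *)
Record rkhs (R : realType) (X : Type) (k : X -> X -> R) := Rkhs {
  rkhs_set : set (X -> R) ;
  rkhs_dot : (X -> R) -> (X -> R) -> R ;
  rkhs_zero : rkhs_set (fun=> 0) ;
  rkhs_lin : forall (a : R) f g, rkhs_set f -> rkhs_set g ->
    rkhs_set (fun x => a * f x + g x) ;
  rkhs_dotC : forall f g, rkhs_set f -> rkhs_set g ->
    rkhs_dot f g = rkhs_dot g f ;
  rkhs_dot_lin : forall (a : R) f g h,
    rkhs_set f -> rkhs_set g -> rkhs_set h ->
    rkhs_dot (fun x => a * f x + g x) h = a * rkhs_dot f h + rkhs_dot g h ;
  rkhs_dot_ge0 : forall f, rkhs_set f -> 0 <= rkhs_dot f f ;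
  rkhs_dot_eq0 : forall f, rkhs_set f -> rkhs_dot f f = 0 -> f = (fun=> 0) ;
  rkhs_complete : forall u : nat -> X -> R, (forall n, rkhs_set (u n)) ->
    (forall e, 0 < e -> exists n0, forall m n, (n0 <= m)%N -> (n0 <= n)%N ->
      Num.sqrt (rkhs_dot (u m \- u n) (u m \- u n)) < e) ->
    exists2 f, rkhs_set f &
      (fun n => Num.sqrt (rkhs_dot (u n \- f) (u n \- f))) @ \oo --> (0 : R) ;
  rkhs_kernel : forall x, rkhs_set (k^~ x) ;
  rkhs_reproducing : forall f x, rkhs_set f -> f x = rkhs_dot f (k^~ x) }.

Definition rkhs_norm (R : realType) (X : Type) (k : X -> X -> R) (H : rkhs k)
  (f : X -> R) : R := Num.sqrt (rkhs_dot H f f).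

Definition gauge_function (R : realType) (T : topologicalType)
    (phi : T -> R) : Prop :=
  [/\ continuous phi, (forall z, 0 <= phi z) &
      exists2 K : set T, compact K & forall z, ~ K z -> 1 <= phi z].

Definition enlarge (R : realType) (T : Type) (dist : T -> T -> R) (A : set T)
  (e : R) : set T := [set y | exists2 x, A x & dist y x < e].

(* Stated for set functions, so that it applies to a [pushforward] without a
   proof of measurability. *)
Definition prokhorov (R : realType) d (T : measurableType d)
    (dist : T -> T -> R) (P Q : set T -> \bar R) : R :=
  inf [set e : R | 0 < e /\ forall A : set T, measurable A ->
    (P A <= Q (enlarge dist A e) + e%:E)%E].

Definition phi_dist (R : realType) d (T : measurableType d)
    (dist : T -> T -> R) (phi : T -> R) (P Q : probability T R) : R :=
  prokhorov dist P Q + `| \int[P]_z phi z - \int[Q]_z phi z |.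

Section power_probability.
Context d (T : measurableType d) (R : realType) (P : probability T R).

Section step.
Variables (n : nat) (Pn : probability (n.-tuple T) R).

Let consT (p : T * n.-tuple T) : n.+1.-tuple T := [tuple of p.1 :: p.2].

Let measurable_consT : measurable_fun setT consT.
Proof. exact: measurable_cons. Qed.

HB.instance Definition _ := isMeasurableFun.Build _ _ _ _ consT
  measurable_consT.

Definition power_step : probability (n.+1.-tuple T) R :=
  distribution (P \x Pn)%E consT.

End step.

Fixpoint power_probability (n : nat) : probability (n.-tuple T) R :=
  match n return probability (n.-tuple T) R with
  | 0 => dirac ([tuple] : 0.-tuple T)
  | n'.+1 => power_step (power_probability n')
  end.

Lemma power_probability_box n (A : 'I_n -> set T) :
  (forall i, measurable (A i)) ->
  power_probability n [set t | forall i, A i (tnth t i)] =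
  (\prod_(i < n) P (A i))%E.
Proof.
elim: n A => [|n IHn] A mA.
  rewrite big_ord0 /= /dirac indicE (_ : _ \in _ = true)//.
  by apply/mem_set => -[].
rewrite big_ord_recl -(IHn (fun i => A (lift ord0 i)))//.
rewrite -[LHS]/((P \x power_probability n)%E
  ((fun p : T * n.-tuple T => [tuple of p.1 :: p.2] : n.+1.-tuple T)
    @^-1` [set t | forall i, A i (tnth t i)])).
rewrite [X in (_ \x _)%E X](_ : _ = A ord0 `*`
    [set t : n.-tuple T | forall i, A (lift ord0 i) (tnth t i)]); last first.
  apply/seteqP; split => [[x t] /= h|[x t] /= [h0 h] i].
    by split=> [|i]; [have := h ord0; rewrite tnth0|
      have := h (lift ord0 i); rewrite tnthS].
  case: (unliftP ord0 i) => [j ->|->]; first by rewrite tnthS.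
  by rewrite tnth0.
rewrite product_measure1E//.
have -> : [set t : n.-tuple T | forall i, A (lift ord0 i) (tnth t i)] =
    \bigcap_(i in [set: 'I_n]) ((@tnth n T)^~ i @^-1` A (lift ord0 i)).
  by apply/seteqP; split=> t /= h i => [_|]; exact: h.
apply: fin_bigcap_measurable => // i _.
by rewrite -[X in measurable X]setTI; exact: measurable_tnth.
Qed.

End power_probability.

Definition reg_risk (R : realType) (E : normedModType R) (X : set E)
    (Y : set R) (k : X -> X -> R) (H : rkhs k) (F : set (X -> Y))
    (c : (X * Y) * Y -> R) (N : nat) (lam : R) (z : N.-tuple (X * Y)) : R :=
  inf [set r : R | exists2 f, F f &
    r = N%:R^-1 * \sum_(i < N) c (tnth z i, f (tnth z i).1) +
        lam * rkhs_norm H (fun x => \val (f x)) ^+ 2].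

(* Main.v *)
(* Both laws are close to the same Dirac mass, so it is enough that, with high
   probability under Q^N and uniformly over Q near P in M, the regularized risk
   is close to one number theta.

   The functions g_f(z) = c(z, f(x)), f in F, are pointwise equicontinuous: the
   feature map x |-> k(., x) is continuous by (K-a), hence F, bounded in the
   RKHS, is equicontinuous and pointwise bounded, and c is uniformly continuous
   near {z} x (Y /\ [-B, B]), Y being closed. As Z is separable, countably many
   balls cover it on which all g_f oscillate by at most e/24. A Lipschitz
   partition h_j subordinate to finitely many of these balls gives
     |mean g_f - sum_j P(h_j) g_f(cen_j)|
        <= e/24 + mean (phi (1 - w)) + sum_j phi(cen_j) |mean h_j - P(h_j)|
   with w = sum_j h_j, uniformly in f, and theta is the infimum over f of
   sum_j P(h_j) g_f(cen_j). The expectation of the right-hand side under Q^N is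
   small: Q(h_j) and Q(1 - w) are close to P(h_j) and P(1 - w) by the Prokhorov
   metric, the variance of mean h_j is at most 1/N, and the bound on the moments
   of order p > 1 makes phi uniformly integrable. *)

Require Import Defs.
From HB Require Import structures.
From mathcomp Require Import all_boot all_order all_algebra.
From mathcomp Require Import all_classical all_reals all_analysis.
From mathcomp Require Import measurable_realfun.
From mathcomp Require Import ring lra.

Set Implicit Arguments.
Unset Strict Implicit.
Unset Printing Implicit Defensive.

Import Order.TTheory GRing.Theory Num.Theory.
Import numFieldNormedType.Exports.

Local Open Scope classical_set_scope.
Local Open Scope ring_scope.

(** * Moments of sums under product measures *)

Section power.
Context d (T : measurableType d) (R : realType) (P : probability T R).

Lemma measurable_fun_cons n :
  measurable_fun setT (fun p : T * n.-tuple T => [tuple of p.1 :: p.2]).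
Proof. exact: measurable_cons. Qed.

Lemma ge0_integral_power_succ n (f : n.+1.-tuple T -> \bar R) :
  measurable_fun [set: n.+1.-tuple T] f -> (forall t, 0 <= f t)%E ->
  (\int[power_probability P n.+1]_t f t =
   \int[P]_x \int[power_probability P n]_t f [tuple of x :: t])%E.
Proof.
move=> mf f0.
rewrite [LHS](ge0_integral_distribution _ mf f0).
rewrite (@fubini_tonelli1 _ _ _ _ _ _ _
  (fun p : T * n.-tuple T => f [tuple of p.1 :: p.2])) //.
exact: (measurableT_comp mf (@measurable_fun_cons n)).
Qed.

Lemma measurable_fun_sum_tnth n (h : T -> R) : measurable_fun setT h ->
  measurable_fun [set: n.-tuple T] (fun t : n.-tuple T => \sum_(i < n) h (tnth
    t i)).
Proof.
move=> mh; apply: measurable_sum => i.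
exact: (measurableT_comp mh (measurable_tnth i)).
Qed.

Lemma measurable_fun_sum_tnthE n (h : T -> R) : measurable_fun setT h ->
  measurable_fun [set: n.-tuple T] (fun t : n.-tuple T => (\sum_(i < n) h (tnth
    t i))%:E).
Proof. by move=> mh; apply/measurable_EFinP;
  exact: measurable_fun_sum_tnth. Qed.

Lemma integral_power_sum n (psi : T -> R) : measurable_fun setT psi ->
  (forall x, 0 <= psi x) ->
  (\int[power_probability P n]_t (\sum_(i < n) psi (tnth t i))%:E =
   n%:R%:E * \int[P]_x (psi x)%:E)%E.
Proof.
move=> mpsi psi0; elim: n => [|n IHn].
  by rewrite mul0e integral0_eq // => t _; rewrite big_ord0.
rewrite ge0_integral_power_succ; first last.
- by move=> t; rewrite lee_fin sumr_ge0.
- exact: measurable_fun_sum_tnthE.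
transitivity (\int[P]_x ((psi x)%:E + n%:R%:E * \int[P]_x (psi x)%:E))%E.
  apply: eq_integral => x _.
  rewrite -IHn -[X in (X + _)%E](mule1) -(@probability_setT _ _ _
    (power_probability P n)).
  rewrite -integral_cst // -ge0_integralD //; first last.
  - exact: measurable_fun_sum_tnthE.
  - by move=> t _; rewrite lee_fin sumr_ge0.
  - by move=> t _; rewrite lee_fin.
  apply: eq_integral => t _; rewrite big_ord_recl /= -EFinD; congr (_ + _)%:E.
  by apply: eq_bigr => i _; rewrite [tnth _ (lift _ _)]tnthS.
have I0 : (0 <= \int[P]_x (psi x)%:E)%E.
  by apply: integral_ge0 => x _; rewrite lee_fin.
rewrite ge0_integralD //; first last.
- by move=> x _; rewrite mule_ge0 // lee_fin.
- exact/measurable_EFinP.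
- by move=> x _; rewrite lee_fin.
rewrite integral_cst //= probability_setT mule1.
rewrite -[X in (X + _ = _)%E]mul1e -ge0_muleDl ?lee_fin //.
by rewrite -EFinD -natr1 addrC.
Qed.

(* The shift [a] absorbs the coordinate peeled off by the induction. *)
Lemma integral_power_sqr n (h : T -> R) (m a : R) : measurable_fun setT h ->
  (forall x, 0 <= h x <= 1) ->
  (\int[power_probability P n]_t
     ((a + \sum_(i < n) (h (tnth t i) - m)) ^+ 2)%:E <=
   ((a + n%:R * (\int[P]_x h x - m)) ^+ 2 + n%:R)%:E)%E.
Proof.
move=> mh h01; elim: n a => [|n IHn] a.
  rewrite (eq_integral (cst (a ^+ 2)%:E)); last first.
    by move=> t _; rewrite big_ord0 addr0.
  by rewrite integral_cst //= diracT mule1 mul0r !addr0.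
have mS k : measurable_fun [set: k.-tuple T] (fun t : k.-tuple T =>
    ((a + \sum_(i < k) (h (tnth t i) - m)) ^+ 2)%:E).
  apply/measurable_EFinP; apply: measurable_funX; apply: measurable_funD => //.
  by apply: (@measurable_fun_sum_tnth _ (fun x => h x - m));
    apply: measurable_funB.
rewrite ge0_integral_power_succ; first last.
- by move=> t; rewrite lee_fin sqr_ge0.
- exact: mS.
have ih : P.-integrable setT (EFin \o h).
  apply: measurable_bounded_integrable => //.
    by rewrite -ge0_fin_numE // fin_num_measure.
  exists 1; split => // x x1 y _ /=; case/andP: (h01 y) => h0 h1.
  by rewrite ger0_norm // (le_trans h1) // ltW.
have [p hp] : exists p : R, (\int[P]_x (h x)%:E = p%:E)%E.
  by exists (fine (\int[P]_x (h x)%:E)); rewrite fineK // integrable_fin_num.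
have hpR : \int[P]_x h x = p by rewrite /Rintegral hp.
rewrite hpR in IHn *.
(* With the first coordinate fixed at [x], the induction hypothesis with shift [a + (h x - m)] gives
   [(b + h x) ^+ 2 + n%:R]. Bounding [h x ^+ 2] by 1 makes this affine in [h x], so that its
   integral involves only the mean [p]. *)
set b := a + n%:R * (p - m) - m.
apply: (@le_trans _ _ (\int[P]_x ((b ^+ 2 + 1 + n%:R) %:E + (2 * b)%:E * (h
  x)%:E))%E).
  apply: ge0_le_integral => //.
  - by move=> x _; apply: integral_ge0 => t _; rewrite lee_fin sqr_ge0.
  - apply: (@measurable_fun_fubini_tonelli_F _ _ _ _ _ (power_probability P n)
      ((fun t : n.+1.-tuple T =>
    ((a + \sum_(i < n.+1) (h (tnth t i) - m)) ^+ 2)%:E) \o (fun p : T *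
      n.-tuple T => [tuple of p.1 :: p.2]))).
      by apply: measurableT_comp; [exact: mS|exact: measurable_fun_cons].
    by move=> t; rewrite lee_fin sqr_ge0.
  - by apply: emeasurable_funD => //; apply: emeasurable_funM => //;
    apply/measurable_EFinP.
  move=> x _; rewrite (eq_integral (fun t : n.-tuple T => ((a + (h x - m) +
    \sum_(i < n) (h (tnth t i) - m)) ^+ 2)%:E)); last first.
    move=> t _; rewrite big_ord_recl /= addrA; congr ((_ + _) ^+ 2)%:E.
    by apply: eq_bigr => i _; rewrite [tnth _ (lift _ _)]tnthS.
  apply: (le_trans (IHn _)); rewrite -EFinM -EFinD lee_fin.
  have /andP[h0 h1] := h01 x.
  have : h x ^+ 2 <= 1 by rewrite expr_le1.
  have -> : a + (h x - m) + n%:R * (p - m) = b + h x by rewrite /b; ring.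
  by rewrite sqrrD; lra.
rewrite integralD //; first last.
- exact: integrableZl.
- by apply: finite_measure_integrable_cst.
rewrite integralZl // hp integral_cst //= probability_setT mule1 -EFinM -EFinD
  lee_fin.
have -> : a + n.+1%:R * (p - m) = b + p by rewrite /b -natr1; ring.
rewrite -[n.+1%:R]natr1; clearbody b.
by rewrite sqrrD; have := sqr_ge0 p; lra.
Qed.

End power.

(** * Lipschitz functions and the Prokhorov metric *)

Section unit_valued.
Context d (T : measurableType d) (R : realType) (P : probability T R).
Variable h : T -> R.
Hypothesis mh : measurable_fun setT h.
Hypothesis h01 : forall x, 0 <= h x <= 1.

Lemma integrable01 : P.-integrable setT (EFin \o h).
Proof.
apply: measurable_bounded_integrable => //.
  by rewrite -ge0_fin_numE // fin_num_measure.
exists 1; split => // x x1 y _ /=; case/andP: (h01 y) => h0 h1.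
by rewrite ger0_norm // (le_trans h1) // ltW.
Qed.

Lemma EFin_Rintegral01 : (\int[P]_x (h x)%:E = (\int[P]_x h x)%:E)%E.
Proof. by rewrite /Rintegral fineK // integrable_fin_num //;
  exact: integrable01. Qed.

Lemma Rintegral01 : 0 <= \int[P]_x h x <= 1.
Proof.
have h0 x : 0 <= h x by case/andP: (h01 x).
have h1 x : h x <= 1 by case/andP: (h01 x).
rewrite -!lee_fin -EFin_Rintegral01; apply/andP; split.
  by apply: integral_ge0 => x _; rewrite lee_fin.
rewrite -(@probability_setT _ _ _ P) -[leRHS]mul1e -integral_cst //.
apply: ge0_le_integral => //; first by move=> x _; rewrite lee_fin.
  exact/measurable_EFinP.
by move=> x _; rewrite lee_fin.
Qed.

End unit_valued.

Lemma Rintegral01B d (T : measurableType d) (R : realType) (P : probability T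
  R) (h : T -> R) :
  measurable_fun setT h -> (forall x, 0 <= h x <= 1) ->
  \int[P]_x (1 - h x) = 1 - \int[P]_x h x.
Proof.
move=> mh h01; rewrite RintegralB //; last exact: integrable01.
  by rewrite Rintegral_cst //= probability_setT mulr1.
exact: finite_measure_integrable_cst.
Qed.

(** The sum counts the positive integers up to [u], capped at [n], so it is the integer part of [u]
    until the cap is reached. The saturated case feeds the induction. *)
Lemma sum_levels (R : realType) (u : R) n : 0 <= u ->
  (n%:R <= u -> \sum_(k < n) (k.+1%:R <= u)%R%:R = n%:R :> R) /\
  (u <= n%:R -> u - 1 <= \sum_(k < n) (k.+1%:R <= u)%R%:R <= u).
Proof.
move=> u0; elim: n => [|n [IH1 IH2]].
  by rewrite !big_ord0; split => // un; apply/andP; split; lra.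
rewrite !big_ord_recr /=; have n1 : n%:R + 1 = n.+1%:R :> R by rewrite natr1.
have [nu|un] := leP (n.+1%:R) u.
  have nu' : n%:R <= u by lra.
  by rewrite (IH1 nu') mulr1n; split => [_|?]; [|apply/andP; split]; lra.
rewrite mulr0n addr0; split; first lra.
move=> _; have [nu'|un'] := leP (n%:R) u.
  by rewrite (IH1 nu'); apply/andP; split; lra.
by apply: IH2; rewrite ltW.
Qed.

Section levels.
Context d (T : measurableType d) (R : realType).
Variable h : T -> R.
Hypothesis mh : measurable_fun setT h.
Hypothesis h01 : forall x, 0 <= h x <= 1.

Definition level n k : set T := [set x | k%:R <= n%:R * h x].

Lemma in_level n k x : (x \in level n k) = (k%:R <= n%:R * h x).
Proof. by apply/idP/idP; rewrite inE. Qed.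

Lemma measurable_level n k : measurable (level n k).
Proof.
rewrite -[X in measurable X]setTI.
have -> : level n k = (fun x => n%:R * h x) @^-1` `[k%:R, +oo[%classic.
  by apply/seteqP; split => x /=; rewrite in_itv /= andbT.
by apply: (measurable_funM _ mh) => //; exact: measurable_itv.
Qed.

(** Layer-cake formula on a grid: at each point the number of levels met is the integer part of
    [n%:R * h x], which falls short of [n%:R * h x] by at most 1; then integrate. *)
Lemma Rintegral_levels (P : probability T R) n :
  \sum_(k < n) fine (P (level n k.+1)) <= n%:R * \int[P]_x h x <=
  1 + \sum_(k < n) fine (P (level n k.+1)).
Proof.
have h0 x : 0 <= h x by case/andP: (h01 x).
have h1 x : h x <= 1 by case/andP: (h01 x).
have E : ((\sum_(k < n) fine (P (level n k.+1)))%:E =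
    \int[P]_x (\sum_(k < n) (k.+1%:R <= n%:R * h x)%R%:R)%:E)%E.
  rewrite (eq_integral (fun x => \sum_(k < n) (\1_(level n k.+1) x)%:E)%E);
    last first.
    move=> x _; rewrite sumEFin; congr EFin; apply: eq_bigr => k _.
    by rewrite indicE in_level.
  rewrite ge0_integral_sum //; last first.
    move=> k; apply/measurable_EFinP; apply: measurable_indic;
      exact: measurable_level.
  rewrite -sumEFin; apply: eq_bigr => k _.
  rewrite integral_indic //; last exact: measurable_level.
  by rewrite setIT fineK // fin_num_measure //; exact: measurable_level.
have ms : measurable_fun setT
    (fun x => (\sum_(k < n) (k.+1%:R <= n%:R * h x)%R%:R)%:E : \bar R).
  rewrite (_ : (fun _ => _) = (fun x => (\sum_(k < n) (\1_(level n k.+1)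
    x))%:E)); last first.
    apply/funext => x; congr EFin; apply: eq_bigr => k _.
    by rewrite indicE in_level.
  apply/measurable_EFinP; apply: measurable_sum => k.
  exact/measurable_indic/measurable_level.
have Eh : (\int[P]_x (n%:R * h x)%:E = (n%:R * \int[P]_x h x)%:E)%E.
  under eq_integral do rewrite EFinM.
  rewrite ge0_integralZl_EFin //; [|by move=> x _;
    rewrite lee_fin|exact/measurable_EFinP].
  by rewrite EFin_Rintegral01 // -EFinM.
have mnh : measurable_fun setT (fun x => (n%:R * h x)%:E).
  by apply/measurable_EFinP; exact: measurable_funM.
have s0 x : 0 <= \sum_(k < n) (k.+1%:R <= n%:R * h x)%R%:R :> R by apply:
  sumr_ge0.
have nh0 x : 0 <= n%:R * h x by rewrite mulr_ge0.
have nhn x : n%:R * h x <= n%:R by rewrite ler_piMr.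
rewrite -!lee_fin -Eh EFinD E; apply/andP; split.
  apply: ge0_le_integral => // x _; rewrite lee_fin //.
  by case: (sum_levels n (nh0 x)) => _ /(_ (nhn x)) /andP[].
have -> : (1%:E = \int[P]_x (cst 1%:E x) :> \bar R)%E.
  by rewrite integral_cst //= probability_setT mule1.
rewrite -ge0_integralD //; last by move=> x _; rewrite lee_fin.
apply: ge0_le_integral => //.
- by move=> x _; rewrite lee_fin.
- by apply: emeasurable_funD.
move=> x _; rewrite -EFinD lee_fin.
by case: (sum_levels n (nh0 x)) => _ /(_ (nhn x)) /andP[]; lra.
Qed.

End levels.

Section prokhorov.
Context d (T : measurableType d) (R : realType) (dist : T -> T -> R).
Hypothesis menlarge : forall A r, measurable (enlarge dist A r).

Lemma prokhorov_lt (P Q : probability T R) r : prokhorov dist P Q < r ->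
  exists e, [/\ 0 < e, e < r & forall A, measurable A ->
    (P A <= Q (enlarge dist A e) + e%:E)%E].
Proof.
move=> /inf_lt[].
  (* [1] is admissible for any two probabilities, so the infimum is over a nonempty set. *)
  exists 1; split => // A mA.
  apply: (le_trans (probability_le1 P mA)).
  by rewrite leeDr.
by move=> e [e0 he] er; exists e.
Qed.

(* [h] is within [n^-1] of the average of the indicators of its [n] levels, and
   enlarging a level set by [e] lowers its level by at most one. *)
Lemma Rintegral_prokhorov (P Q : probability T R) (h : T -> R) L e n :
  measurable_fun setT h -> (forall x, 0 <= h x <= 1) -> 0 <= L ->
  (forall x y, h x <= h y + L * dist y x) ->
  (forall A, measurable A -> (P A <= Q (enlarge dist A e) + e%:E)%E) ->
  (0 < n)%N -> n%:R * (L * e) <= 1 ->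
  \int[P]_x h x <= \int[Q]_x h x + (2 * n%:R^-1 + e).
Proof.
move=> mh h01 L0 hL PQ n0 nLe.
have n0R : 0 < n%:R :> R by rewrite ltr0n.
have key k : fine (P (level h n k.+1)) <= fine (Q (level h n k)) + e.
  rewrite -lee_fin EFinD !fineK ?fin_num_measure //;
    try exact: measurable_level.
  apply: (le_trans (PQ _ (measurable_level mh n k.+1))).
  rewrite leeD2r //; apply: le_measure; rewrite ?inE //;
    first exact: measurable_level.
  move=> y [x]; rewrite /level /= -natr1 => xk /ltW yx.
  have : n%:R * h x <= n%:R * (h y + L * dist y x) by rewrite ler_pM2l.
  have : n%:R * (L * dist y x) <= n%:R * (L * e) by rewrite ler_pM2l //
    ler_wpM2l.
  by rewrite mulrDr; lra.
have /andP[_ uP] := Rintegral_levels mh h01 P n.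
have /andP[lQ _] := Rintegral_levels mh h01 Q n.
have sPQ : \sum_(k < n) fine (P (level h n k.+1)) <=
    1 + \sum_(k < n) fine (Q (level h n k.+1)) + n%:R * e.
  apply: (@le_trans _ _ (\sum_(k < n) (fine (Q (level h n k)) + e))).
    by apply: ler_sum => k _.
  rewrite big_split /= sumr_const card_ord -[X in _ + X]mulr_natl lerD2r.
  (* Levels 0 to n - 1 are compared with levels 1 to n: level 0 costs at most 1, and the mass of
     level n is nonnegative. *)
  case: (n) n0 => // k _; rewrite big_ord_recl [in leRHS]big_ord_recr /=.
  have q0 : fine (Q (level h k.+1 0)) <= 1.
    rewrite -lee_fin fineK ?fin_num_measure ?probability_le1 //;
      exact: measurable_level.
  have : 0 <= fine (Q (level h k.+1 k.+1)) by apply: fine_ge0.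
  by rewrite /bump /=; lra.
rewrite -(ler_pM2l n0R) !mulrDr mulrCA divff ?lt0r_neq0 // mulr1.
by lra.
Qed.

(** [delta] depends on [L] and [eps] alone, hence serves all these functions at once. The one-sided
    bound for [h] and for [1 - h] gives both signs; [dist] is not assumed symmetric here, whence two
    Lipschitz conditions. *)
Lemma prokhorov_Lipschitz L eps : 0 <= L -> 0 < eps -> exists2 delta, 0 < delta
  &
  forall (P Q : probability T R) (h : T -> R), prokhorov dist P Q <= delta ->
  measurable_fun setT h -> (forall x, 0 <= h x <= 1) ->
  (forall x y, h x <= h y + L * dist y x) ->
  (forall x y, h y <= h x + L * dist y x) ->
  `|\int[Q]_x h x - \int[P]_x h x| <= eps.
Proof.
move=> L0 eps0; pose n := (Num.truncn (4 / eps)).+1.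
have n0 : 0 < n%:R :> R by rewrite ltr0n.
have en : 2 * n%:R^-1 <= eps / 2.
  have : 4 / eps < n%:R by exact: truncnS_gt.
  by rewrite ltr_pdivrMr // ler_pdivrMr //; lra.
(* The radius [e] found below is less than [2 * del]: the first bound gives [e <= eps / 2], the
   second [n%:R * (L * e) <= 1]. The denominator uses [L + 1] to stay positive when [L] is 0. *)
pose del := Num.min (eps / 4) (1 / (2 * n%:R * (L + 1))).
have Lp : 0 < L + 1 by lra.
have d0 : 0 < del by rewrite lt_min; apply/andP; split;
  [lra|rewrite divr_gt0 // !mulr_gt0].
exists del => // P Q h PQd mh h01 hL hL'.
have /prokhorov_lt[e [e0 ed PQ]] : prokhorov dist P Q < 2 * del by lra.
have e1 : e <= eps / 2.
  have : del <= eps / 4 by rewrite ge_min lexx.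
  by lra.
have e2 : n%:R * (L * e) <= 1.
  have : del <= 1 / (2 * n%:R * (L + 1)) by rewrite ge_min lexx orbT.
  rewrite ler_pdivlMr ?mulr_gt0 // => h2.
  have : n%:R * (L * e) <= n%:R * ((L + 1) * (2 * del)).
    rewrite ler_pM2l // ler_pM //; lra.
  by lra.
have B1 := Rintegral_prokhorov mh h01 L0 hL PQ (ltn0Sn _) e2.
have mh' : measurable_fun setT (fun x => 1 - h x) by exact: measurable_funB.
have h01' x : 0 <= 1 - h x <= 1 by case/andP: (h01 x) => ? ?; apply/andP;
  split; lra.
have hLC x y : 1 - h x <= 1 - h y + L * dist y x by have := hL' x y; lra.
have := Rintegral_prokhorov mh' h01' L0 hLC PQ (ltn0Sn _) e2.
rewrite !Rintegral01B // ler_norml => B2.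
by apply/andP; split; move: B1 B2 en; rewrite -/n; lra.
Qed.

End prokhorov.

(** * Lipschitz partitions of unity *)

Lemma measurable_fun_lt d (T : measurableType d) (R : realType) (f : T -> R) :
  (forall r, measurable [set x | f x < r]) -> measurable_fun setT f.
Proof.
move=> mf mD; apply: (measurability _ (RGenInftyO.measurableE R)) => //.
move=> _ [_ [r ->] <-]; rewrite setTI.
have -> : f @^-1` `]-oo, r[ = [set x | f x < r]; last exact: mf.
by apply/seteqP; split => x /=; rewrite in_itv.
Qed.

Section partition.
Context d (T : measurableType d) (R : realType) (dist : T -> T -> R).
Hypothesis menlarge : forall A r, measurable (enlarge dist A r).
Hypothesis distC : forall x y, dist x y = dist y x.
Hypothesis distD : forall y x z, dist x z <= dist x y + dist y z.
Variables (cen : nat -> T) (rad : nat -> R).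

Lemma dist_ge0 x y : 0 <= dist x y.
Proof. by have := distD y x x; have := distD x x x; rewrite (distC y x);
  lra. Qed.

Lemma measurable_dist c : measurable_fun setT (dist^~ c).
Proof.
apply: measurable_fun_lt => r.
rewrite [X in measurable X](_ : _ = enlarge dist [set c] r) //.
by apply/seteqP; split => [x xr|x [_ ->]//]; exists c.
Qed.

(** A ramp of slope [m] inside the ball, capped at 1; it increases with [m] to the indicator of the
    open ball. *)
Definition bump_fun (m j : nat) (z : T) : R :=
  Num.min 1 (m%:R * Num.max 0 (rad j - dist z (cen j))).

Fixpoint cover_fun (m n : nat) (z : T) : R :=
  if n is j.+1 then Num.max (cover_fun m j z) (bump_fun m j z) else 0.

(** Increments of a running maximum telescope to [cover_fun], vanish off their own ball and stay
    Lipschitz, with no division by a sum of bumps. *)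
Definition piece_fun m j z := cover_fun m j.+1 z - cover_fun m j z.

Lemma bump_fun_le1 m j z : bump_fun m j z <= 1.
Proof. by rewrite ge_min lexx. Qed.

Lemma bump_fun_Lip m j x y :
  bump_fun m j x <= bump_fun m j y + m%:R * dist x y.
Proof.
have xy := dist_ge0 x y.
have m0 : 0 <= m%:R * dist x y by rewrite mulr_ge0.
rewrite /bump_fun addr_minl le_min; apply/andP; split.
  by rewrite ge_min; apply/orP; left; lra.
rewrite ge_min; apply/orP; right.
rewrite -mulrDr ler_wpM2l // ge_max; apply/andP; split.
  by rewrite addr_ge0 // le_max lexx.
have : rad j - dist y (cen j) <= Num.max 0 (rad j - dist y (cen j)) by rewrite
  le_max lexx orbT.
have := distD x y (cen j); rewrite (distC y x).
by lra.
Qed.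

Lemma cover_fun01 m n z : 0 <= cover_fun m n z <= 1.
Proof.
elim: n => [|n /andP[IH0 IH1]] /=; first by rewrite lexx ler01.
by rewrite le_max IH0 ge_max IH1 bump_fun_le1.
Qed.

Lemma cover_fun_Lip m n x y :
  cover_fun m n x <= cover_fun m n y + m%:R * dist x y.
Proof.
have xy := dist_ge0 x y.
elim: n => [|n IH] /=; first by rewrite add0r mulr_ge0.
by rewrite ge_max addr_maxl !le_max IH bump_fun_Lip orbT.
Qed.

Lemma measurable_cover_fun m n : measurable_fun setT (cover_fun m n).
Proof.
elim: n => [|n IH] /=; first exact: measurable_cst.
apply: measurable_maxr => //; apply: measurable_minr => //.
apply: measurable_funM => //; apply: measurable_maxr => //.
by apply: measurable_funB => //; exact: measurable_dist.
Qed.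

Lemma piece_fun01 m j z : 0 <= piece_fun m j z <= 1.
Proof.
have /andP[h1 h2] := cover_fun01 m j z;
  have /andP[h3 h4] := cover_fun01 m j.+1 z.
rewrite /piece_fun; apply/andP; split; last by lra.
by rewrite subr_ge0 /= le_max lexx.
Qed.

Lemma measurable_piece_fun m j : measurable_fun setT (piece_fun m j).
Proof. by apply: measurable_funB; exact: measurable_cover_fun. Qed.

Lemma piece_fun_Lip m j x y :
  piece_fun m j x <= piece_fun m j y + (2 * m%:R) * dist x y.
Proof.
have := cover_fun_Lip m j.+1 x y; have := cover_fun_Lip m j y x.
by rewrite (distC y x) /piece_fun; lra.
Qed.

Lemma sum_piece_fun m n z : \sum_(j < n) piece_fun m j z = cover_fun m n z.
Proof.
elim: n => [|n IH]; first by rewrite big_ord0.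
by rewrite big_ord_recr /= IH /piece_fun addrC subrK.
Qed.

Lemma piece_fun_supp m j z : rad j <= dist z (cen j) -> piece_fun m j z = 0.
Proof.
move=> rz; rewrite /piece_fun /= (_ : bump_fun m j z = 0); last first.
  by rewrite /bump_fun max_l ?subr_le0 // mulr0 min_r.
by rewrite max_l ?subrr //; case/andP: (cover_fun01 m j z).
Qed.

Lemma bump_le_cover_fun m n j z : (j < n)%N -> bump_fun m j z <= cover_fun m n
  z.
Proof.
elim: n => // n IH; rewrite ltnS leq_eqVlt => /predU1P[->|jn] /=.
  by rewrite le_max lexx orbT.
by rewrite le_max IH.
Qed.

Hypothesis cover : forall z, exists j, dist z (cen j) < rad j.

Lemma cover_fun_eventually z : \forall m \near \oo, cover_fun m m z = 1.
Proof.
have [j jz] := cover z.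
have r0 : 0 < rad j - dist z (cen j) by rewrite subr_gt0.
(* The same [m] is the number of balls and the slope: it must pass the index [j] of a ball
   containing [z], and be steep enough for the ramp of that ball to reach 1 at [z]. *)
exists (maxn j.+1 (Num.truncn (rad j - dist z (cen j))^-1).+1) => // m /=.
rewrite geq_max => /andP[jm rm].
have v1 : bump_fun m j z = 1.
  rewrite /bump_fun max_r ?(ltW r0)// min_l //.
  rewrite -ler_pdivrMr // mul1r.
  apply/ltW/(lt_le_trans (truncnS_gt _)); by rewrite ler_nat.
by apply/le_anti; have /andP[_ ->] := cover_fun01 m m z;
  rewrite /= -v1 bump_le_cover_fun.
Qed.

(** Dominated convergence with bound 1, as the integrand is eventually 0 at every point. *)
Lemma cvg_Rintegral_cover_fun (P : probability T R) (e : R) : 0 < e ->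
  exists m, \int[P]_z (1 - cover_fun m m z) <= e.
Proof.
move=> e0.
have m01 m x : 0 <= 1 - cover_fun m m x <= 1.
  by have /andP[] := cover_fun01 m m x; move=> ? ?; apply/andP; split; lra.
have mm m : measurable_fun setT (fun x => 1 - cover_fun m m x).
  by apply: measurable_funB => //; exact: measurable_cover_fun.
have cv : (fun m => \int[P]_z (1 - cover_fun m m z)) @ \oo --> 0.
  have : (fun m => \int[P]_z (1 - cover_fun m m z)%:E)%E @ \oo --> (\int[P]_z
    (cst 0 z))%E.
    apply: (@dominated_cvg _ _ _ P setT measurableT _ _ (cst 1%E)) => //.
    - by move=> m; apply/measurable_EFinP.
    - move=> x _; apply: cvg_near_cst; near=> m; congr EFin.
      by rewrite (near (cover_fun_eventually x)) // subrr.
    - exact: finite_measure_integrable_cst.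
    - by move=> m x _; rewrite lee_fin; case/andP: (m01 m x) => ? ?;
      rewrite ger0_norm.
  by rewrite integral0 => /fine_cvgP[].
move/cvgrPdist_le : cv => /(_ _ e0)[m _ /(_ m (leqnn _))] /=.
by rewrite sub0r normrN => /(le_trans (ler_norm _)); exists m.
Unshelve. all: by end_near.
Qed.
End partition.

(* AM-GM *)
Lemma ler_norm_sqr (R : realFieldType) (x s : R) : 0 < s -> `|x| <= s + s^-1 *
  x ^+ 2.
Proof.
move=> s0; rewrite -real_normK ?num_real // mulrC.
rewrite (_ : s + _ = (s ^+ 2 + `|x| ^+ 2) / s); last by field; rewrite gt_eqF.
rewrite ler_pdivlMr //; set y := `|x|.
by have := sqr_ge0 (s - y); have := sqr_ge0 s; have := sqr_ge0 y; nra.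
Qed.

(** * Concentration of regularized infima *)

(** Taking infima is 1-Lipschitz for the uniform distance. The bound [b] keeps both sets bounded
    below, since [inf] of an unbounded set is only a default value. *)
Lemma ler_dist_inf (R : realType) (I : Type) (F : set I) (u v : I -> R) (D b :
  R) :
  F !=set0 -> (forall f, F f -> `|u f - v f| <= D) -> (forall f, F f -> b <= v
    f) ->
  `|inf [set r | exists2 f, F f & r = u f] - inf [set r | exists2 f, F f & r =
    v f]| <= D.
Proof.
move=> [f0 Ff0] uv bv.
have key (a c : I -> R) l : (forall f, F f -> l <= a f) -> (forall f, F f -> a
  f <= c f + D) ->
    inf [set r | exists2 f, F f & r = a f] <= inf [set r | exists2 f, F f & r =
      c f] + D.
  move=> la ac; rewrite -lerBlDr; apply: lb_le_inf; first by exists (c f0), f0.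
  move=> _ [f Ff ->]; rewrite lerBlDr; apply: le_trans (ac _ Ff).
  by apply: ge_inf; [exists l => _ [f' Ff' ->]; exact: la|exists f].
rewrite ler_distl; apply/andP; split.
  rewrite lerBlDr; apply: (key v u b) => // f Ff.
  by have := uv f Ff; rewrite ler_distl => /andP[]; lra.
apply: (key u v (b - D)) => f Ff; have := uv f Ff;
  rewrite ler_distl => /andP[]; have := bv f Ff; lra.
Qed.

Section concentration.
Context d (T : measurableType d) (R : realType) (dist : T -> T -> R).
Hypothesis menlarge : forall A r, measurable (enlarge dist A r).
Hypothesis distC : forall x y, dist x y = dist y x.
Hypothesis distD : forall y x z, dist x z <= dist x y + dist y z.
Variables (I : Type) (F : set I) (g : I -> T -> R) (phi : T -> R).
Hypothesis F0 : F !=set0.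
Hypothesis g_ge0 : forall f z, F f -> 0 <= g f z.
Hypothesis g_le : forall f z, F f -> g f z <= phi z.
Hypothesis mphi : measurable_fun setT phi.

Let phi_ge0 z : 0 <= phi z.
Proof. by have [f Ff] := F0; exact: le_trans (g_ge0 z Ff) (g_le z Ff). Qed.

Definition empirical_mean N (t : N.-tuple T) (h : T -> R) : R :=
  N%:R^-1 * \sum_(i < N) h (tnth t i).

Section approximation.
Variables (cen : nat -> T) (rad : nat -> R) (e1 : R) (m : nat).
Hypothesis osc : forall f j z, F f -> dist z (cen j) < rad j ->
  `|g f z - g f (cen j)| <= e1.

Let tail z := phi z * (1 - cover_fun dist cen rad m m z).

(** The pieces sum to [cover_fun], so the error splits into a weighted sum of [g f z - g f (cen j)]
    over balls containing [z], and the uncovered share of [g f z], which [phi] dominates. *)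
Lemma piece_approx f z : F f -> 0 <= e1 ->
  `|g f z - \sum_(j < m) piece_fun dist cen rad m j z * g f (cen j)| <= e1 +
    tail z.
Proof.
move=> Ff e10; have /andP[w0 w1] := cover_fun01 dist cen rad m m z.
have -> : g f z - \sum_(j < m) piece_fun dist cen rad m j z * g f (cen j) =
  \sum_(j < m) piece_fun dist cen rad m j z * (g f z - g f (cen j)) +
  g f z * (1 - cover_fun dist cen rad m m z).
  under [in RHS]eq_bigr do rewrite mulrBr.
  rewrite sumrB -mulr_suml sum_piece_fun; ring.
apply: (le_trans (ler_normD _ _)); apply: lerD; last first.
  by rewrite ger0_norm ?mulr_ge0 ?ler_wpM2r ?subr_ge0 ?g_ge0 ?g_le.
apply: (le_trans (ler_norm_sum _ _ _)).
apply: (@le_trans _ _ (\sum_(j < m) piece_fun dist cen rad m j z * e1)).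
  apply: ler_sum => j _; have /andP[p0 _] := piece_fun01 dist cen rad m j z.
  rewrite normrM (ger0_norm p0).
  have [jz|jz] := ltP (dist z (cen j)) (rad j);
    first by rewrite ler_wpM2l // osc.
  by rewrite piece_fun_supp // !mul0r.
by rewrite -mulr_suml sum_piece_fun ler_piMl.
Qed.

(** The bound is free of [f], so it passes to infima. Averaging [piece_approx] over the sample gives
    the first two terms; replacing the empirical weights by [a j] gives the last, as
    [g f <= phi]. *)
Lemma empirical_approx N (t : N.-tuple T) f (a : 'I_m -> R) : (0 < N)%N -> F f
  -> 0 <= e1 ->
  `|empirical_mean t (g f) - \sum_(j < m) a j * g f (cen j)| <=
  e1 + empirical_mean t tail +
  \sum_(j < m) phi (cen j) * `|empirical_mean t (piece_fun dist cen rad m j) -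
    a j|.
Proof.
move=> N0 Ff e10; have N0R : 0 < N%:R :> R by rewrite ltr0n.
have -> : empirical_mean t (g f) - \sum_(j < m) a j * g f (cen j) =
  N%:R^-1 * \sum_(i < N) (g f (tnth t i) - \sum_(j < m) piece_fun dist cen rad
    m j (tnth t i) * g f (cen j)) +
  \sum_(j < m) g f (cen j) * (empirical_mean t (piece_fun dist cen rad m j) - a
    j).
  rewrite sumrB exchange_big /= mulrBr -addrA; congr (_ + _).
  rewrite mulr_sumr -!sumrN -big_split /=; apply: eq_bigr => j _.
  rewrite /empirical_mean -mulr_suml; ring.
apply: (le_trans (ler_normD _ _)); apply: lerD.
  have i0 : 0 <= N%:R^-1 :> R by rewrite invr_ge0 ltW.
  rewrite normrM (ger0_norm i0).
  have -> : e1 + empirical_mean t tail = N%:R^-1 * \sum_(i < N) (e1 + tail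
    (tnth t i)).
    rewrite big_split /= mulrDr sumr_const card_ord -[e1 *+ N]mulr_natl mulrA
      mulVf ?lt0r_neq0 //.
    by rewrite mul1r.
  rewrite ler_wpM2l //; apply: (le_trans (ler_norm_sum _ _ _)).
  by apply: ler_sum => i _; exact: piece_approx.
apply: (le_trans (ler_norm_sum _ _ _)); apply: ler_sum => j _.
by rewrite normrM (ger0_norm (g_ge0 _ Ff)) ler_wpM2r ?g_le.
Qed.

End approximation.
(** Truncation at height [A]: where [phi] is at most [A], [phi * h] is at most [A * h]; elsewhere it
    is at most [phi], hence at most the p-th power of [phi] divided by A^(p-1), whose integral the
    moment bound controls. *)
Lemma tail_moment (Q : probability T R) (h : T -> R) (p kappa A : R) :
  measurable_fun setT h -> (forall z, 0 <= h z <= 1) -> 1 < p -> 0 < A ->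
  (\int[Q]_z (phi z `^ p)%:E <= kappa%:E)%E ->
  (\int[Q]_z (phi z * h z)%:E <= (A * \int[Q]_z h z + kappa / A `^ (p -
    1))%:E)%E.
Proof.
move=> mh h01 p1 A0 kP.
have h0 z : 0 <= h z by case/andP: (h01 z).
have h1 z : h z <= 1 by case/andP: (h01 z).
have K0 : 0 < A `^ (p - 1) by rewrite powR_gt0.
have mphip : measurable_fun setT (fun z => phi z `^ p) by apply:
  (@measurableT_comp _ _ _ _ _ _ (@powR R ^~ p)).
apply: (@le_trans _ _ (\int[Q]_z (A%:E * (h z)%:E + ((A `^ (p - 1))^-1)%:E *
  (phi z `^ p)%:E))%E).
  apply: ge0_le_integral => //.
  - by move=> z _; rewrite lee_fin mulr_ge0.
  - by apply/measurable_EFinP; exact: measurable_funM.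
  - by apply: emeasurable_funD; apply: emeasurable_funM => //;
    apply/measurable_EFinP.
  move=> z _; rewrite -!EFinM -EFinD lee_fin.
  have [zA|Az] := leP (phi z) A.
    by rewrite -[leLHS]addr0 lerD // ?ler_wpM2r // mulr_ge0 ?invr_ge0 ?powR_ge0
      // ltW.
  rewrite -[leLHS]add0r lerD //; first by rewrite mulr_ge0 // ltW.
  apply: (@le_trans _ _ (phi z)); first by rewrite ler_piMr.
  rewrite ler_pdivlMl //.
  have phi0' : 0 < phi z by exact: lt_trans Az.
  have -> : phi z `^ p = phi z `^ (p - 1) * phi z.
    rewrite -[X in _ = _ * X](powRr1 (phi_ge0 z)) -powRD ?subrK //.
    by rewrite (gt_eqF phi0') implybT.
  rewrite ler_wpM2r // ge0_ler_powR ?nnegrE ?(ltW A0) ?(ltW Az) //; lra.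
rewrite ge0_integralD //; first last.
- by apply: emeasurable_funM => //; apply/measurable_EFinP.
- by move=> z _; rewrite -EFinM lee_fin mulr_ge0 ?invr_ge0 ?powR_ge0 // ltW.
- by apply: emeasurable_funM => //; apply/measurable_EFinP.
- by move=> z _; rewrite -EFinM lee_fin mulr_ge0 // ltW.
rewrite EFinD; apply: leeD.
  rewrite ge0_integralZl_EFin //; [|by move=> z _;
    rewrite lee_fin|exact/measurable_EFinP|exact: ltW].
  by rewrite EFin_Rintegral01 // EFinM.
rewrite ge0_integralZl_EFin //; [|by move=> z _;
  rewrite lee_fin powR_ge0|exact/measurable_EFinP|by rewrite invr_ge0 ltW].
by rewrite mulrC EFinM lee_wpmul2l // lee_fin invr_ge0 ltW.
Qed.

Lemma measurable_empirical_mean N (h : T -> R) : measurable_fun setT h ->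
  measurable_fun setT (fun t : N.-tuple T => empirical_mean t h).
Proof. by move=> mh; apply: measurable_funM => //;
  exact: measurable_fun_sum_tnth. Qed.

Lemma integral_empirical_mean (Q : probability T R) N (h : T -> R) : (0 < N)%N
  ->
  measurable_fun setT h -> (forall x, 0 <= h x) ->
  (\int[power_probability Q N]_t (empirical_mean t h)%:E = \int[Q]_x (h
    x)%:E)%E.
Proof.
move=> N0 mh h0; under eq_integral do rewrite /empirical_mean EFinM.
rewrite ge0_integralZl_EFin //; first last.
- exact: measurable_fun_sum_tnthE.
- by move=> t _; rewrite lee_fin sumr_ge0.
rewrite integral_power_sum // muleA -EFinM mulVf ?mul1e //.
by rewrite pnatr_eq0 -lt0n.
Qed.

(** Squared bias plus variance: [integral_power_sqr] with shift 0, scaled by 1/N^2. *)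
Lemma integral_empirical_sqr (Q : probability T R) N (h : T -> R) (a : R) : (0
  < N)%N ->
  measurable_fun setT h -> (forall x, 0 <= h x <= 1) ->
  (\int[power_probability Q N]_t ((empirical_mean t h - a) ^+ 2)%:E <=
   ((\int[Q]_x h x - a) ^+ 2 + N%:R^-1)%:E)%E.
Proof.
move=> N0 mh h01; have N0R : 0 < N%:R :> R by rewrite ltr0n.
have NN : (N%:R^-1) ^+ 2 * N%:R = N%:R^-1 :> R by rewrite expr2 -mulrA mulVf
  ?mulr1 // lt0r_neq0.
rewrite (eq_integral (fun t : N.-tuple T => ((N%:R^-1) ^+ 2)%:E *
    ((0 + \sum_(i < N) (h (tnth t i) - a)) ^+ 2)%:E)%E); last first.
  move=> t _; rewrite -EFinM -exprMn add0r; congr (_ ^+ 2)%:E.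
  rewrite sumrB sumr_const card_ord -[a *+ N]mulr_natl mulrBr mulrA mulVf
    ?lt0r_neq0 //.
  by rewrite mul1r.
rewrite ge0_integralZl_EFin ?sqr_ge0 //; first last.
- apply/measurable_EFinP; apply: measurable_funX; apply: measurable_funD => //.
  by apply: (@measurable_fun_sum_tnth _ _ _ _ (fun x => h x - a));
    apply: measurable_funB.
- by move=> t _; rewrite lee_fin sqr_ge0.
apply: le_trans (lee_wpmul2l _ (integral_power_sqr Q N a 0 mh h01)) _.
  by rewrite lee_fin sqr_ge0.
rewrite -EFinM lee_fin add0r mulrDr NN lerD2r exprMn mulrA -exprMn mulVf
  ?lt0r_neq0 //.
by rewrite expr1n mul1r.
Qed.

(** [theta], [delta] and [N0] are fixed before [Q], so one [theta] serves [P] and all its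
    neighbours. [W] comes from Markov's inequality and does not depend on the penalty [q]. *)
Lemma concentration (P : probability T R) (p kappa e : R) (cen : nat -> T) (rad
  : nat -> R) :
  1 < p -> 0 <= kappa -> 0 < e ->
  (forall f j z, F f -> dist z (cen j) < rad j -> `|g f z - g f (cen j)| <= e /
    24) ->
  (forall z, exists j, dist z (cen j) < rad j) ->
  exists (theta delta : R) (N0 : nat), 0 < delta /\
  forall Q : probability T R, (\int[Q]_z (phi z `^ p)%:E <= kappa%:E)%E ->
  prokhorov dist P Q <= delta -> forall N, (N0 < N)%N ->
  exists2 W : set (N.-tuple T), measurable W /\ (power_probability Q N W <=
    e%:E)%E &
  forall (q : I -> R), (forall f, F f -> 0 <= q f <= e / 6) ->
  forall t, ~ W t ->
  `|inf [set r | exists2 f, F f & r = empirical_mean t (g f) + q f] - theta| <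
    e / 2.
Proof.
move=> p1 kappa0 e0 osc cover.
(* [A] is the height at which [phi] is truncated; it solves A^(p-1) = K, so that the moment term
   kappa/K is at most e^2/48. The summand 1 keeps [K] positive when [kappa] is 0. *)
pose K := 48 * kappa / e ^+ 2 + 1; pose A := K `^ (p - 1)^-1.
have ee0 : 0 < e ^+ 2 by rewrite exprn_gt0.
have K0 : 0 < K by rewrite /K ltr_wpDl // divr_ge0 // ?(ltW ee0) // mulr_ge0.
have A0 : 0 < A by rewrite powR_gt0.
have AK : A `^ (p - 1) = K by rewrite -powRrM mulVf ?powRr1 ?(ltW K0) //; lra.
have kK : kappa / K <= e ^+ 2 / 48.
  have kE : e ^+ 2 / 48 * (48 * kappa / e ^+ 2) = kappa by field;
    rewrite gt_eqF.
  by rewrite ler_pdivrMr // /K mulrDr mulr1 kE lerDl divr_ge0 // ltW.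
(* [m] leaves uncovered so little mass of [P] that [A] times it is at most e^2/48. *)
have [|m mP] := cvg_Rintegral_cover_fun menlarge cover P (e := e ^+ 2 / (48 *
  A)).
  by rewrite divr_gt0 // mulr_gt0.
set w := cover_fun dist cen rad m m in mP *.
pose h j := piece_fun dist cen rad m j.
pose B := \sum_(j < m) phi (cen j).
have B0 : 0 <= B by apply: sumr_ge0.
(* [s] is the weight in [ler_norm_sqr]; the constant terms then add up to [s * B], at most e/24. *)
pose s := e / (24 * (B + 1)).
have s0 : 0 < s by rewrite divr_gt0 // mulr_gt0 //; lra.
have sB : s * B <= e / 24.
  rewrite /s -mulrA; have : B / (24 * (B + 1)) <= 24^-1; last first.
    by move=> h24; rewrite [X in e * X]mulrC ler_wpM2l // ltW.
  by rewrite ler_pdivrMr; lra.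
(* [eta] bounds the change of the integrals from [P] to [Q]. Being at most 1, it dominates its
   square, the squared bias; the other two bounds keep it small after multiplication by [A] and by
   [s^-1 * B]. *)
pose eta := Num.min 1 (Num.min (e ^+ 2 / (48 * A)) (e ^+ 2 * s / (96 * (B +
  1)))).
have B10 : 0 < B + 1 by lra.
have eta0 : 0 < eta by rewrite !lt_min ltr01 /=; apply/andP; split;
  rewrite divr_gt0 // mulr_gt0.
have etaA : A * eta <= e ^+ 2 / 48.
  apply: (@le_trans _ _ (A * (e ^+ 2 / (48 * A)))).
    by rewrite ler_wpM2l ?(ltW A0) // !ge_min lexx orbT.
  by rewrite le_eqVlt; apply/orP; left; apply/eqP; field; rewrite gt_eqF.
have etaB : s^-1 * (B * eta) <= e ^+ 2 / 96.
  rewrite ler_pdivrMl // mulrC;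
    apply: (@le_trans _ _ (e ^+ 2 * s / (96 * (B + 1)) * (B + 1))).
    by apply: ler_pM => //; [exact: ltW|rewrite !ge_min lexx !orbT|lra].
  by rewrite le_eqVlt; apply/orP; left; apply/eqP; field; rewrite gt_eqF.
have [|delta delta0 deltaP] := prokhorov_Lipschitz menlarge (L := 2 * m%:R) _
  eta0.
  by rewrite mulr_ge0.
(* Beyond [N0] the total variance term, B/(sN), is at most e^2/96. *)
pose N0 := Num.truncn (s^-1 * B * 96 / e ^+ 2).
pose a j := \int[P]_z h j z.
exists (inf [set r | exists2 f, F f & r = \sum_(j < m) a j * g f (cen j)]),
  delta, N0.
split => // Q kQ PQ N N0N.
have N_gt0 : (0 < N)%N by exact: leq_ltn_trans N0N.
have NB : s^-1 * (B * N%:R^-1) <= e ^+ 2 / 96.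
  have : s^-1 * B * 96 / e ^+ 2 < N%:R.
    by apply: lt_le_trans (truncnS_gt _) _; rewrite ler_nat.
  rewrite ltr_pdivrMr // => h1.
  by rewrite mulrA ler_pdivrMr ?ltr0n //; lra.
have hQ j : `|\int[Q]_z h j z - a j| <= eta.
  apply: (deltaP P Q (h j)) => //.
  - exact: measurable_piece_fun.
  - by move=> x; exact: piece_fun01.
  - by move=> x y; rewrite [dist y x]distC; exact: piece_fun_Lip.
  - by move=> x y; exact: piece_fun_Lip.
have mw : measurable_fun setT (fun z => 1 - w z).
  by apply: measurable_funB => //; exact: measurable_cover_fun.
have w01 z : 0 <= 1 - w z <= 1.
  by have /andP[] := cover_fun01 dist cen rad m m z; move=> ? ?; apply/andP;
    split; rewrite /w; lra.
have wQ : \int[Q]_z (1 - w z) <= \int[P]_z (1 - w z) + eta.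
  suff : `|\int[Q]_z (1 - w z) - \int[P]_z (1 - w z)| <= eta.
    by rewrite ler_distl => /andP[]; lra.
  apply: (deltaP P Q (fun z => 1 - w z)) => //.
    move=> x y; have := cover_fun_Lip distC distD cen rad m m y x; rewrite -/w.
    by have := mulr_ge0 (ler0n R m) (dist_ge0 distC distD y x); lra.
  move=> x y; have := cover_fun_Lip distC distD cen rad m m x y;
    rewrite -/w [dist x y]distC.
  by have := mulr_ge0 (ler0n R m) (dist_ge0 distC distD y x); lra.
pose psi z := phi z * (1 - w z).
have psi0 z : 0 <= psi z by rewrite mulr_ge0 //; case/andP: (w01 z).
have mpsi : measurable_fun setT psi by exact: measurable_funM.
(* Three shares of e^2/48: [A] times the uncovered mass of [P], the transfer error [A * eta], and
   the moment term kappa/K. *)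
have psiQ : (\int[Q]_z (psi z)%:E <= (e ^+ 2 / 16)%:E)%E.
  apply: (le_trans (tail_moment mw w01 p1 A0 kQ)); rewrite lee_fin AK.
  have : A * \int[Q]_z (1 - w z) <= A * (e ^+ 2 / (48 * A) + eta).
    by rewrite ler_wpM2l ?(ltW A0) //; lra.
  have -> : A * (e ^+ 2 / (48 * A) + eta) = e ^+ 2 / 48 + A * eta by field;
    rewrite gt_eqF.
  by lra.
pose V (t : N.-tuple T) := s^-1 * \sum_(j < m) phi (cen j) * (empirical_mean t
  (h j) - a j) ^+ 2.
pose G t := empirical_mean t psi + V t.
have V0 t : 0 <= V t.
  by rewrite mulr_ge0 ?invr_ge0 ?(ltW s0) // sumr_ge0 // => j _;
    rewrite mulr_ge0 ?sqr_ge0.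
have mV1 j : measurable_fun setT (fun t : N.-tuple T => phi (cen j) *
  (empirical_mean t (h j) - a j) ^+ 2).
  apply: measurable_funM => //; apply: measurable_funX;
    apply: measurable_funB => //.
  by apply: measurable_empirical_mean; exact: measurable_piece_fun.
have mV : measurable_fun setT V by apply: measurable_funM => //;
  exact: measurable_sum.
have memp : measurable_fun setT (fun t : N.-tuple T => empirical_mean t psi) by
  exact: measurable_empirical_mean.
have emp0 t : 0 <= empirical_mean t psi :> R.
  by rewrite mulr_ge0 ?invr_ge0 // sumr_ge0.
have mG : measurable_fun setT G by exact: measurable_funD.
have G0 t : 0 <= G t by rewrite addr_ge0.
have VQ : (\int[power_probability Q N]_t (V t)%:E <= (e ^+ 2 / 48)%:E)%E.
  under eq_integral do rewrite EFinM -sumEFin.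
  rewrite ge0_integralZl_EFin ?invr_ge0 ?(ltW s0) //; first last.
  - by apply: emeasurable_sum => j; apply/measurable_EFinP.
  - by move=> t _; apply: sume_ge0 => j _; rewrite lee_fin mulr_ge0 ?sqr_ge0.
  rewrite ge0_integral_sum //; first last.
  - by move=> j t _; rewrite lee_fin mulr_ge0 ?sqr_ge0.
  - by move=> j; apply/measurable_EFinP.
  apply: (@le_trans _ _ (s^-1%:E * \sum_(j < m) (phi (cen j) * (eta +
    N%:R^-1))%:E)%E).
    rewrite lee_wpmul2l ?lee_fin ?invr_ge0 ?(ltW s0) //; apply: lee_sum => j _.
    under eq_integral do rewrite EFinM.
    rewrite ge0_integralZl_EFin //; first last.
    - apply/measurable_EFinP; apply: measurable_funX;
      apply: measurable_funB => //.
      by apply: measurable_empirical_mean; exact: measurable_piece_fun.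
    - by move=> t _; rewrite lee_fin sqr_ge0.
    rewrite EFinM lee_wpmul2l ?lee_fin //.
    apply: (le_trans (integral_empirical_sqr Q (a j) N_gt0
      (measurable_piece_fun menlarge cen rad m j) _)).
      by move=> x; exact: piece_fun01.
    rewrite lee_fin lerD2r -/(h j) -real_normK ?num_real //.
    have h1 := hQ j; have eta1 : eta <= 1 by rewrite ge_min lexx.
    apply: (@le_trans _ _ (eta * 1)); last by rewrite mulr1.
    by rewrite expr2 ler_pM //; exact: le_trans eta1.
  rewrite sumEFin -EFinM lee_fin -mulr_suml -/B mulrDr mulrDr; lra.
have GQ : (\int[power_probability Q N]_t (G t)%:E <= (e / 12 * e)%:E)%E.
  under eq_integral do rewrite EFinD.
  rewrite ge0_integralD //; first last.
  - exact/measurable_EFinP.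
  - by move=> t _; rewrite lee_fin.
  - exact/measurable_EFinP.
  - by move=> t _; rewrite lee_fin.
  rewrite integral_empirical_mean //.
  have -> : e / 12 * e = e ^+ 2 / 16 + e ^+ 2 / 48 by field.
  by rewrite EFinD leeD.
(* Markov's inequality: the mean of [G] is at most [e / 12 * e], so [G] reaches [e / 12] with
   probability at most [e]. *)
exists [set t | e / 12 <= G t].
  have mE : measurable [set t | e / 12 <= G t].
    rewrite [X in measurable X](_ : _ = G @^-1` `[e / 12, +oo[%classic).
      by rewrite -[X in measurable X]setTI; apply: mG => //;
        exact: measurable_itv.
    by apply/seteqP; split => t /=; rewrite in_itv /= andbT.
  split => //.
  have e12 : 0 < e / 12 by rewrite divr_gt0.
  have := @le_integral_abse _ _ _ (power_probability Q N) setT measurableT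
    (EFin \o G) (e / 12) _ e12.
  rewrite setTI => /(_ (proj2 (measurable_EFinP _ _) mG)).
  have -> : [set x | (e / 12)%:E <= `|(EFin \o G) x|]%E = [set t | e / 12 <= G
    t].
    by apply/seteqP; split => t /=; rewrite lee_fin ger0_norm.
  under eq_integral do rewrite /= ger0_norm //.
  by move=> /le_trans /(_ GQ);
    rewrite [(e / 12 * e)%:E]EFinM lee_pmul2l ?lte_fin.
move=> q hq t /= /negP; rewrite -ltNge => Gt.
(* Budget: e/24 for the oscillation, e/24 for [s * B], less than e/12 for [G t], and e/6 for the
   penalty, which [theta] ignores. *)
apply: (@le_lt_trans _ _ (e / 24 + e / 24 + G t + e / 6)); last by lra.
apply: (@ler_dist_inf _ _ _ (fun f => empirical_mean t (g f) + q f) (fun f =>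
  \sum_(j < m) a j * g f (cen j)) _ 0) => //; last first.
  move=> f Ff; apply: sumr_ge0 => j _; rewrite mulr_ge0 ?g_ge0 //.
  by have /andP[] := Rintegral01 P (measurable_piece_fun menlarge cen rad m j)
    (piece_fun01 dist cen rad m j).
move=> f Ff; have /andP[q0 q6] := hq f Ff.
rewrite addrAC; apply: (le_trans (ler_normD _ _)); apply: lerD;
  last by rewrite ger0_norm.
apply: le_trans (empirical_approx osc t (fun j : 'I_m => a j) N_gt0 Ff _) _;
  first by rewrite divr_ge0 // ltW.
rewrite /G -/w -/psi.
suff : \sum_(j < m) phi (cen j) * `|empirical_mean t (h j) - a j| <= e / 24 + V
  t by rewrite -/(h _); lra.
apply: (@le_trans _ _ (s * B + V t)); last by rewrite lerD2r.
rewrite /B /V !mulr_sumr -big_split /=; apply: ler_sum => j _.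
set x := empirical_mean _ _ - _; set b := phi _.
rewrite (_ : s * b + _ = b * (s + s^-1 * x ^+ 2)); last by ring.
by apply: ler_wpM2l; [exact: phi_ge0|exact: ler_norm_sqr].
Qed.

End concentration.

(* [r < a] holds exactly on the union of the countably many boxes of cover sets
   on which it holds everywhere. *)
Lemma measurable_fun_osc d (T : measurableType d) (R : realType) N (r :
  N.-tuple T -> R) :
  (forall e : R, 0 < e -> exists U : nat -> set T,
    [/\ forall j, measurable (U j), forall z, exists j, U j z &
    forall t t', (forall i, exists2 j, U j (tnth t i) & U j (tnth t' i)) ->
      r t' <= r t + e]) ->
  measurable_fun setT r.
Proof.
move=> osc; apply: measurable_fun_lt => a.
have /choice[U UP] n : exists U : nat -> set T,
    [/\ forall j, measurable (U j), forall z, exists j, U j z &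
    forall t t', (forall i, exists2 j, U j (tnth t i) & U j (tnth t' i)) ->
      r t' <= r t + n.+1%:R^-1].
  by apply: osc; rewrite invr_gt0.
pose box (k : nat * N.-tuple nat) : set (N.-tuple T) :=
  [set t | forall i, U k.1 (tnth k.2 i) (tnth t i)].
have mbox k : measurable (box k).
  rewrite (_ : box k = \bigcap_(i in [set: 'I_N])
    ((fun t : N.-tuple T => tnth t i) @^-1` U k.1 (tnth k.2 i))); last first.
    by apply/seteqP; split => t h i => [_|]; exact: h.
  apply: fin_bigcap_measurable => // i _.
  rewrite -[X in measurable X]setTI; apply: measurable_tnth => //.
  by have [] := UP k.1.
rewrite [X in measurable X](_ : _ =
    \bigcup_k (if `[< box k `<=` [set t | r t < a] >] then box k else set0)).
  apply: countable_bigcupT_measurable => [|k]; first exact: countableP.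
  by case: ifP.
apply/seteqP; split => [t /= ta|t [k _]]; last by case: asboolP => // h /h.
(* On a box of mesh [n] containing [t], [r] exceeds [r t] by less than [a - r t], so the whole box
   lies in the sublevel set. *)
pose n := Num.truncn (a - r t)^-1.
have na : n.+1%:R^-1 < a - r t.
  by rewrite invf_plt ?posrE ?subr_gt0 //; exact: truncnS_gt.
have [_ cov tP] := UP n.
have /choice[s sP] i : exists j, U n j (tnth t i) by exact: cov.
exists (n, [tuple s i | i < N]) => //.
rewrite asboolT => [i|t' t'P] /=; first by rewrite tnth_mktuple; exact: sP.
have : r t' <= r t + n.+1%:R^-1.
  apply: tP => i; exists (s i); first exact: sP.
  by have := t'P i; rewrite /= tnth_mktuple.
by move=> h; apply: (le_lt_trans h); rewrite -ltrBrDl.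
Qed.

(** Dichotomy on [A]: if it has a point within e/2 of [theta], its [e]-enlargement contains the
    whole e/2-ball around [theta], to which the second law gives mass at least 1 - e; if not, its
    preimage under [r1] lies in [W1]. *)
Lemma le_prokhorov_pushforward d1 d2 (T1 : measurableType d1) (T2 :
  measurableType d2)
  (R : realType) (P1 : probability T1 R) (P2 : probability T2 R)
  (r1 : T1 -> R) (r2 : T2 -> R) (theta e : R) (W1 : set T1) (W2 : set T2) :
  0 < e -> measurable_fun setT r1 -> measurable_fun setT r2 ->
  measurable W1 -> measurable W2 -> (P1 W1 <= e%:E)%E -> (P2 W2 <= e%:E)%E ->
  (forall t, ~ W1 t -> `|r1 t - theta| < e / 2) ->
  (forall t, ~ W2 t -> `|r2 t - theta| < e / 2) ->
  prokhorov (fun x y : R => `|x - y|) (pushforward P1 r1) (pushforward P2 r2)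
    <= e.
Proof.
move=> e0 mr1 mr2 mW1 mW2 PW1 PW2 h1 h2.
apply: ge_inf; first by exists 0 => x [/ltW].
split => // A mA; rewrite /pushforward.
have mA1 : measurable (r1 @^-1` A) by rewrite -[X in measurable X]setTI;
  exact: mr1.
have mA2 : measurable (r2 @^-1` (enlarge (fun x y : R => `|x - y|) A e)).
  rewrite -[X in measurable X]setTI; apply: mr2 => //; apply: open_measurable.
  rewrite (_ : enlarge _ A e = \bigcup_(x in A) ball x e).
    by apply: bigcup_open => x _; exact: ball_open.
  by apply/seteqP; split => [y [x Ax xy]|y [x Ax xy]]; exists x => //; move: xy;
    rewrite /ball /= distrC.
have [[a Aa ath]|nA] := pselect (exists2 a, A a & `|a - theta| < e / 2).
  apply: (le_trans (probability_le1 _ mA1)).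
  rewrite -(probability_setT P2) -(setvU W2) measureU ?setICl //;
    last exact: measurableC.
  apply: leeD => //; apply: le_measure; rewrite ?inE //;
    first exact: measurableC.
  move=> t /h2 ht; exists a => //.
  have -> : r2 t - a = (r2 t - theta) - (a - theta) by ring.
  by apply: le_lt_trans (ler_normB _ _) _; lra.
apply: (@le_trans _ _ e%:E); last by rewrite leeDr.
apply: le_trans PW1; apply: le_measure; rewrite ?inE // => t At.
by apply: contrapT => /h1 ht; apply: nA; exists (r1 t).
Qed.

(** * Norms on the product space and kernels *)

Lemma ball_set_type (R : realType) (E : normedModType R) (X : set E) (x x' : X)
  (e : R) :
  ball x e x' <-> `|\val x - \val x'| < e.
Proof. by change (ball (\val x) e (\val x') <-> `|\val x - \val x'| < e);
  rewrite -ball_normE. Qed.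

Section product_norm.
Context (R : realType) (E : normedModType R) (nrm : E * R^o -> R).
Hypothesis nrmP : product_norm nrm.

Lemma product_norm0 : nrm 0 = 0.
Proof. by rewrite -(scale0r 0) (product_normZ nrmP) normr0 mul0r. Qed.

Lemma product_normN v : nrm (- v) = nrm v.
Proof. by rewrite -scaleN1r (product_normZ nrmP) normrN1 mul1r. Qed.

Lemma product_norm_ge0 v : 0 <= nrm v.
Proof.
have := product_normD nrmP v (- v).
by rewrite subrr product_norm0 product_normN; lra.
Qed.

Context (X : set E) (Y : set R).
Local Notation dist := (@embed_dist R E X Y nrm).

Lemma embed_distxx z : dist z z = 0.
Proof. by rewrite /embed_dist subrr product_norm0. Qed.

Lemma embed_distC z z' : dist z z' = dist z' z.
Proof. by rewrite /embed_dist -opprB product_normN. Qed.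

Lemma embed_distD z1 z z2 : dist z z2 <= dist z z1 + dist z1 z2.
Proof.
rewrite /embed_dist; apply: le_trans (product_normD nrmP _ _).
by rewrite addrA subrK.
Qed.

(** [product_norm_nbhs] compares the topologies at 0; differences of points carry the comparison to
    every point of the subspace. *)
Lemma nbhs_embed_dist (z : X * Y) (A : set (X * Y)) :
  nbhs z A <-> exists2 e, 0 < e & [set z' | dist z' z < e] `<=` A.
Proof.
have ball0 (e : R) : 0 < e -> nbhs (0 : E * R^o) [set v | `|v.1| < e /\ `|v.2|
  < e].
  move=> e0; apply/nbhs_ballP; exists e => //= v [].
  by rewrite -!ball_normE /= !sub0r !normrN.
split=> [/nbhs_ballP[e e0 eA]|[e e0 eA]].
  have /(product_norm_nbhs nrmP)[r r0 rP] := ball0 e e0.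
  exists r => // z' /rP /= [h1 h2]; apply: eA; split; apply/ball_set_type.
    by rewrite distrC.
  by rewrite distrC.
have : nbhs (0 : E * R^o) [set v | nrm v < e] by apply/(product_norm_nbhs
  nrmP); exists e.
move=> /nbhs_ballP[r r0 rP]; apply/nbhs_ballP; exists r => // z' [].
move=> /ball_set_type h1 /ball_set_type h2; apply: eA => /=; apply: rP.
by split; rewrite -ball_normE /= sub0r normrN distrC.
Qed.

Lemma open_embed_ball c r : open [set z | dist z c < r].
Proof.
rewrite openE => z /= zr; apply/nbhs_embed_dist.
exists (r - dist z c); first by rewrite subr_gt0.
by move=> z' /= zz'; apply: le_lt_trans (embed_distD z z' c) _; lra.
Qed.

Lemma open_enlarge A r : open (enlarge dist A r).
Proof.
rewrite (_ : enlarge _ A r = \bigcup_(x in A) [set z | dist z x < r]).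
  by apply: bigcup_open => x _; exact: open_embed_ball.
by apply/seteqP; split => [y [x Ax xy]|y [x Ax xy]]; exists x.
Qed.

End product_norm.

Section rkhs.
Context (R : realType) (X : Type) (k : X -> X -> R) (H : rkhs k).

Lemma rkhs_norm_ge0 f : 0 <= rkhs_norm H f.
Proof. exact: sqrtr_ge0. Qed.

Lemma rkhs_cauchy_schwarz f g : rkhs_set H f -> rkhs_set H g ->
  `|rkhs_dot H f g| <= rkhs_norm H f * rkhs_norm H g.
Proof.
move=> Hf Hg; rewrite -sqrtrM ?rkhs_dot_ge0 // -sqrtr_sqr ler_wsqrtr //.
set c := rkhs_dot H f g; set F := rkhs_dot H f f; set G := rkhs_dot H g g.
have F0 : 0 <= F by exact: rkhs_dot_ge0.
have quad a : 0 <= a ^+ 2 * F + 2 * a * c + G.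
  have Hh := rkhs_lin a Hf Hg.
  have := rkhs_dot_ge0 Hh; rewrite rkhs_dot_lin //.
  rewrite (rkhs_dotC Hf Hh) (rkhs_dotC Hg Hh) !rkhs_dot_lin // (rkhs_dotC Hg
    Hf) -/c -/F -/G.
  by congr (0 <= _); ring.
(* If [F] is 0, the form is affine in the scalar and a nonzero [c] would let it take the value -1.
   Otherwise evaluate it at its minimum, [- c / F]. *)
have [F00|Fn0] := eqVneq F 0.
  have [->|c0] := eqVneq c 0; first by rewrite expr0n /= mulr_ge0 ?rkhs_dot_ge0.
  have := quad (- (G + 1) / (2 * c)).
  rewrite F00 mulr0 add0r (_ : _ + G = -1) ?ler0N1 //; by field.
have Fp : 0 < F by rewrite lt_neqAle eq_sym Fn0.
have := quad (- c / F); rewrite (_ : _ + G = (F * G - c ^+ 2) / F);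
  last by field.
by rewrite pmulr_lge0 ?invr_gt0 // subr_ge0.
Qed.

Lemma rkhs_setB f g : rkhs_set H f -> rkhs_set H g -> rkhs_set H (f \- g).
Proof.
move=> Hf Hg; have := rkhs_lin (-1) Hg Hf; congr (rkhs_set H _).
by apply/funext => x; rewrite mulN1r addrC.
Qed.

(** By the reproducing property, the increment of [f] is its inner product with the increment of the
    kernel sections. *)
Lemma rkhs_lipschitz f x x' : rkhs_set H f ->
  `|f x' - f x| <= rkhs_norm H f * rkhs_norm H (k^~ x' \- k^~ x).
Proof.
move=> Hf; have Hk := rkhs_kernel H; have HB := rkhs_setB (Hk x') (Hk x).
rewrite [f x' in leLHS](rkhs_reproducing x' Hf) [f x in leLHS](rkhs_reproducing
  x Hf).
suff -> : rkhs_dot H f (k^~ x') - rkhs_dot H f (k^~ x) = rkhs_dot H f (k^~ x'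
  \- k^~ x).
  exact: rkhs_cauchy_schwarz.
rewrite (rkhs_dotC Hf HB) (_ : _ \- _ = (fun y => (-1) * k y x + k y x'));
  last first.
  by apply/funext => y; rewrite mulN1r addrC.
by rewrite rkhs_dot_lin // !(rkhs_dotC Hf) // mulN1r addrC.
Qed.

End rkhs.

(** If [l] is not a cluster point of the filter, some neighbourhood of [l] misses a member of it.
    That neighbourhood holds all but finitely many terms, so the filter lives on a finite set. *)
Lemma compact_cvg_seq (T : topologicalType) (u : nat -> T) (l : T) :
  u @ \oo --> l -> compact (range u `|` [set l]).
Proof.
move=> ul F FF FA.
have [lF|] := pselect (cluster F l); first by exists l; split => //; right.
move=> /existsNP[A /existsNP[B /not_implyP[FA' /not_implyP[lB AB]]]].
have [N _ NP] := ul _ lB.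
have fin : finite_set (u @` [set n | (n < N)%N]) by apply: finite_image;
  exact: finite_II.
have [|z [zu zF]] := finite_compact fin FF.
  apply: filterS (filterI FA FA') => z [[[n _ <-]|->] Az].
    have [nN|Nn] := ltnP n N; first by exists n.
    by exfalso; apply: AB; exists (u n); split => //; exact: NP.
  by exfalso; apply: AB; exists l; split => //; exact: nbhs_singleton.
by exists z; split => //; left; case: zu => n _ <-; exists n.
Qed.

(** * Equicontinuity of the costs *)

Section equicontinuity.
Context (R : realType) (E : normedModType R) (X : set E) (Y : set R) (z0 : X *
  Y).
Context (nrm : E * R^o -> R) (nrmP : product_norm nrm).
Local Notation dist := (@embed_dist R E X Y nrm).
Hypothesis polishZ : polish dist.
Context (k : X -> X -> R) (H : rkhs k).
Hypothesis Ka : forall Z0 : set (X * Y), compact Z0 -> forall e : R, 0 < e ->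
    exists2 eta : R, 0 < eta & forall x x' : X,
      (fst @` Z0) x -> (fst @` Z0) x' -> `|\val x' - \val x| < eta ->
      rkhs_norm H (k^~ x' \- k^~ x) < e.

(** [Ka] is uniform on compact sets only. A sequence tending to [x] and violating continuity forms
    with its limit a compact set, the second coordinate being frozen at [z0.2], and contradicts [Ka]
    there. *)
Lemma kernel_continuous (x : X) (e : R) : 0 < e -> exists2 eta : R, 0 < eta &
  forall x', `|\val x' - \val x| < eta -> rkhs_norm H (k^~ x' \- k^~ x) < e.
Proof.
move=> e0; apply: contrapT => neta.
have /choice[u uP] (n : nat) : exists x', `|\val x' - \val x| < n.+1%:R^-1 /\
    e <= rkhs_norm H (k^~ x' \- k^~ x).
  apply: contrapT => nx; apply: neta; exists n.+1%:R^-1;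
    first by rewrite invr_gt0.
  move=> x' xx'; rewrite ltNge; apply/negP => ex.
  by apply: nx; exists x'.
pose v n : X * Y := (u n, z0.2).
have uln (r : R) : 0 < r -> \forall n \near \oo, `|\val (u n) - \val x| < r.
  move=> r0; near=> n; apply: (lt_trans (proj1 (uP n))).
  by near: n; exact: near_infty_natSinv_lt (PosNum r0).
have vl : v @ \oo --> ((x, z0.2) : X * Y).
  apply/cvg_ballP => r r0; near=> n; split; apply/ball_set_type => /=.
    by rewrite distrC; near: n; exact: uln.
  by rewrite subrr normr0.
have [eta eta0 etaP] := Ka (compact_cvg_seq vl) e0.
near \oo => n.
have := etaP x (u n) _ _ _.
have [_] := uP n; rewrite leNgt => /negP nn h; apply/nn/h.
- by exists (x, z0.2) => //; right.
- by exists (v n) => //; left; exists n.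
- by near: n; exact: uln.
Unshelve. all: by end_near.
Qed.

(* [Y] is closed: a sequence in [Y] converging in the line lifts to a Cauchy
   sequence of [X * Y]. *)
Lemma closed_output (u : R) : ~ Y u ->
  exists2 r : R, 0 < r & forall y : Y, ~ `|\val y - u| < r.
Proof.
move=> nYu; apply: contrapT => nr; apply: nYu.
have /choice[y yP] (n : nat) : exists y : Y, `|\val y - u| < n.+1%:R^-1.
  apply: contrapT => ny; apply: nr; exists n.+1%:R^-1;
    first by rewrite invr_gt0.
  by move=> y yu; apply: ny; exists y.
have yl (r : R) : 0 < r -> exists n0, forall n, (n0 <= n)%N -> `|\val (y n) -
  u| < r.
  move=> r0; have [n0 _ n0P] := near_infty_natSinv_lt (PosNum r0).
  by exists n0 => n n0n; exact: lt_trans (yP n) (n0P n n0n).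
pose v n : X * Y := (z0.1, y n).
have distE m n : dist (v m) (v n) = `|\val (y m) - \val (y n)| * nrm (0, 1).
  rewrite -(product_normZ nrmP); congr nrm; apply/pair_equal_spec; split => /=.
    by rewrite subrr scaler0.
  by rewrite [_ *: _]mulr1.
have nrm0 := product_norm_ge0 nrmP (0, 1).
have [_ /(_ v)[|l vl]] := polishZ.
  move=> e e0; have c0 : 0 < e / (2 * (nrm (0, 1) + 1)) by rewrite divr_gt0 //
    mulr_gt0 //; lra.
  set c := _ / _ in c0; have [n0 n0P] := yl _ c0; exists n0 => m n mn nn;
    rewrite distE.
  have h : `|\val (y m) - \val (y n)| <= 2 * c.
    have -> : \val (y m) - \val (y n) = (\val (y m) - u) - (\val (y n) - u) by
      ring.
    apply: le_trans (ler_normB _ _) _.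
    by have := n0P m mn; have := n0P n nn; clearbody c; lra.
  have c1 : 0 < nrm (0, 1) + 1 by lra.
  apply: (@lt_le_trans _ _ (2 * c * (nrm (0, 1) + 1))).
    apply: le_lt_trans (ler_wpM2r nrm0 h) _; clearbody c; move: c0 => {n0P h};
      lra.
  by rewrite le_eqVlt; apply/orP; left; apply/eqP; rewrite /c; field;
    rewrite gt_eqF.
suff -> : u = \val l.2 by exact: set_valP.
apply/eqP; rewrite -subr_eq0 -normr_le0; apply/ler_addgt0Pr => e e0;
  rewrite add0r.
have e20 : 0 < e / 2 by lra.
have [n0 n0P] := yl _ e20.
have [n1 _ n1P] := (cvg_ballP _ _).1 vl _ e20.
have [_ /ball_set_type] := n1P (maxn n0 n1) (leq_maxr _ _).
have := n0P (maxn n0 n1) (leq_maxl _ _).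
set w := y _ => h1 h2.
have -> : u - \val l.2 = - ((\val w - u) + (\val l.2 - \val w)) by ring.
by rewrite normrN; apply: le_trans (ler_normD _ _) _; move: h1 h2 => /=; lra.
Qed.

(** Lindelof's argument: enumerate the balls with centre in the dense set and radius 1/(n+1), giving
    radius 0, hence an empty ball, to those that are not good. The hypothesis concerns balls inside
    the ball of radius [eta] around [z]. *)
Lemma separable_ball_cover (good : X * Y -> R -> Prop) :
  (forall z, exists2 eta, 0 < eta & forall c r, 0 < r -> dist c z + r <= eta ->
    good c r) ->
  exists (cen : nat -> X * Y) (rad : nat -> R),
    (forall j, 0 < rad j -> good (cen j) (rad j)) /\
    (forall z, exists j, dist z (cen j) < rad j).
Proof.
move=> goodP; have [[D /countable_injP[i i_inj] denseD] _] := polishZ.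
(* [a] inverts the injection [i] of the dense set into the integers, with default value [z0] off its
   range. *)
have /choice[a aP] (n : nat) : exists a, forall d, D d -> i d = n -> a = d.
  have [[d [Dd <-]]|nd] := pselect (exists d, D d /\ i d = n).
    by exists d => d' Dd' di; apply: i_inj; rewrite ?inE.
  by exists z0 => d Dd dn; exfalso; apply: nd; exists d.
pose index j : nat * nat := odflt (0%N, 0%N) (unpickle j).
pose cen j := a (index j).1; pose rd j : R := (index j).2.+1%:R^-1.
exists cen, (fun j => if `[< good (cen j) (rd j) >] then rd j else 0).
split => [j|z]; first by case: asboolP => // _; rewrite ltxx.
have [eta eta0 etaP] := goodP z.
have eta20 : 0 < eta / 2 by lra.
have [m _ /(_ m (leqnn _)) mP] := near_infty_natSinv_lt (PosNum eta20).
have {}mP : m.+1%:R^-1 < eta / 2 := mP.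
have m0 : 0 < m.+1%:R^-1 :> R by rewrite invr_gt0.
have [|d [dz Dd]] := denseD _ _ (@open_embed_ball _ _ _ nrmP X Y z m.+1%:R^-1).
  by exists z; rewrite /= embed_distxx.
exists (pickle (i d, m)).
rewrite /cen /rd /index pickleK /= (aP _ d) // asboolT;
  first by rewrite embed_distC.
by apply: etaP => //; rewrite [eta]splitr lerD // ltW //; exact: lt_trans dz mP.
Qed.

Variables (F : set (X -> Y)) (c : (X * Y) * Y -> R) (beta : R).
Hypothesis F_sub : forall f, F f -> rkhs_set H (fun x => \val (f x)).
Hypothesis Kb : forall f, F f -> rkhs_norm H (fun x => \val (f x)) <= beta.
Hypothesis Cb : continuous c.

(** Compactness of the segment [-B, B] makes a local statement uniform. Near a point of [Y] it is
    continuity of [c]; near a real outside [Y] it is vacuous, [Y] being closed. *)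
Lemma cost_uniform (z : X * Y) (B e : R) : 0 < e -> exists2 s : R, 0 < s &
  forall z' (u : R) (y y' : Y), dist z' z < s -> `|u| <= B ->
  `|\val y - u| < s -> `|\val y' - u| < s -> `|c (z', y') - c (z, y)| < e.
Proof.
move=> e0.
(* The parameter [i] pairs a point near [z] with a tolerance near 0, so a neighbourhood of [(z, 0)]
   provides both radii at once. *)
pose good (i : (X * Y) * R) (u : R) := forall y y' : Y,
  `|\val y - u| < i.2 -> `|\val y' - u| < i.2 -> `|c (i.1, y') - c (z, y)| < e.
have /compact_near_coveringP ncov := @segment_compact R (- B) B.
have H1 (u : R) : `[- B, B]%classic u -> \forall u' \near u & i \near nbhs (z,
  0 : R), good i u'.
  move=> _; have [Yu|nYu] := pselect (Y u).
    pose y0 : Y := SigSub (mem_set Yu).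
    have e20 : 0 < e / 2 by lra.
    have /cvg_ballP/(_ _ e20)/nbhs_ballP[r r0 rP] : c @ (z, y0) --> c (z, y0)
      by exact: Cb.
    have r20 : 0 < r / 2 by rewrite divr_gt0.
    exists (ball u (r / 2), ball z r `*` ball 0 (r / 2)).
      split; first exact: nbhsx_ballx.
      by exists (ball z r, ball (0 : R) (r / 2)); [split; exact: nbhsx_ballx|].
    case=> u' [z' s] [/= uu' [zz' ss]] y y' /= yu' y'u'.
    move: uu' ss; rewrite /ball /= sub0r normrN => uu' ss.
    have key y1 (z1 : X * Y) : ball z r z1 -> `|\val y1 - u'| < s -> `|c (z,
      y0) - c (z1, y1)| < e / 2.
      move=> zz1 y1u'; apply: (rP (z1, y1)); split => //;
        apply/ball_set_type => /=.
      have -> : u - \val y1 = (u - u') - (\val y1 - u') by ring.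
      apply: le_lt_trans (ler_normB _ _) _.
      by rewrite [r]splitr ltrD // (lt_trans y1u') // (le_lt_trans (ler_norm
        s)).
    have -> : c (z', y') - c (z, y) = (c (z, y0) - c (z, y)) - (c (z, y0) - c
      (z', y')) by ring.
    apply: le_lt_trans (ler_normB _ _) _.
    have := key _ _ zz' y'u'; have := key _ _ (ballxx _ r0) yu'; lra.
  have [r r0 rP] := closed_output nYu.
  have r20 : 0 < r / 2 by rewrite divr_gt0.
  exists (ball u (r / 2), setT `*` ball 0 (r / 2)).
    split; first exact: nbhsx_ballx.
    by exists (setT, ball (0 : R) (r / 2)); [split;
      [exact: filterT|exact: nbhsx_ballx]|].
  case=> u' [z' s] [/= uu' [_ ss]] y y' /= yu' _.
  move: uu' ss; rewrite /ball /= sub0r normrN => uu' ss.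
  exfalso; apply: (rP y).
  have -> : \val y - u = (\val y - u') - (u - u') by ring.
  apply: le_lt_trans (ler_normB _ _) _.
  by rewrite [r]splitr ltrD // (lt_trans yu') // (le_lt_trans (ler_norm s)).
have [[A1 A2] [/= /(nbhs_embed_dist nrmP)[s1 s10 s1P] /nbhs_ballP[s2 /= s20
  s2P]] AP] := ncov _ (nbhs (z, 0 : R)) good _ H1.
pose s := Num.min s1 (s2 / 2).
have s0 : 0 < s by rewrite lt_min s10; lra.
exists s => // z' u y y' z'z uB yu y'u.
apply: (AP (z', s) _ u) => //=.
  split; first by apply: s1P => /=; apply: lt_le_trans z'z _;
    rewrite ge_min lexx.
  apply: s2P; rewrite /ball /= sub0r normrN gtr0_norm //.
  by have : s <= s2 / 2 by [rewrite ge_min lexx orbT]; lra.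
by rewrite in_itv /= -ler_norml.
Qed.

(** [cost_uniform] is used with [u] the value of [f] at [z.1]. The reproducing property and [Kb]
    bound [u] by a [B] free of [f], and [rkhs_lipschitz] keeps the value at [z'.1] near [u]. *)
Lemma cost_equicontinuous (z : X * Y) (e : R) : 0 < e -> exists2 r : R, 0 < r &
  forall f z', F f -> dist z' z < r -> `|c (z', f z'.1) - c (z, f z.1)| < e.
Proof.
move=> e0; pose B := beta * rkhs_norm H (k^~ z.1).
have [s s0 sP] := cost_uniform z B e0.
have fB f : F f -> `|\val (f z.1)| <= B.
  move=> Ff; rewrite [\val _](rkhs_reproducing z.1 (F_sub Ff)).
  apply: le_trans (rkhs_cauchy_schwarz (F_sub Ff) (rkhs_kernel H z.1)) _.
  by rewrite ler_wpM2r ?rkhs_norm_ge0 ?Kb.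
have b0 : 0 < `|beta| + 1 by rewrite ltr_wpDl.
have [eta eta0 etaP] := kernel_continuous z.1 (divr_gt0 s0 b0).
have : nbhs z (ball z eta) by exact: nbhsx_ballx.
move=> /(nbhs_embed_dist nrmP)[r1 r10 r1P].
exists (Num.min s r1); first by rewrite lt_min s0.
move=> f z' Ff; rewrite lt_min => /andP[zs zr].
apply: (sP z' (\val (f z.1))) => //; first exact: fB.
  by rewrite subrr normr0.
apply: le_lt_trans (rkhs_lipschitz z.1 z'.1 (F_sub Ff)) _.
have [/ball_set_type/= zz' _] := r1P _ zr.
have := etaP z'.1; rewrite distrC => /(_ zz') h.
apply: (@le_lt_trans _ _ (`|beta| * rkhs_norm H (k^~ z'.1 \- k^~ z.1))).
  by rewrite ler_wpM2r ?rkhs_norm_ge0 // (le_trans (Kb Ff)) // ler_norm.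
move: h; rewrite ltr_pdivlMr //.
by have := rkhs_norm_ge0 H (k^~ z'.1 \- k^~ z.1); lra.
Qed.

End equicontinuity.

(** * Measurability of the regularized risk and stability of its law *)

(** Lets [P] itself play the role of [Q] in [concentration]. *)
Lemma prokhorov_xx d (T : measurableType d) (R : realType) (dist : T -> T -> R)
    (P : probability T R) (e : R) :
  (forall A r, measurable (enlarge dist A r)) -> (forall x, dist x x = 0) ->
  0 < e -> prokhorov dist P P <= e.
Proof.
move=> menlarge dist0 e0; apply: ge_inf; first by exists 0 => x [/ltW].
split => // A mA; apply: (@le_trans _ _ (P (enlarge dist A e))); last first.
  by rewrite leeDl // lee_fin ltW.
by apply: le_measure; rewrite ?inE // => x Ax; exists x => //; rewrite dist0.
Qed.

(** [F] may be uncountable, so the infimum is handled through its oscillation: two samples whose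
    coordinates share balls pairwise have means within [e] of each other for every [f], hence infima
    within [e]. *)
Lemma measurable_fun_regularized_inf d (T : measurableType d) (R : realType)
    (dist : T -> T -> R) (I : Type) (F : set I) (g : I -> T -> R) (q : I -> R)
      N :
  (forall A r, measurable (enlarge dist A r)) -> (0 < N)%N -> F !=set0 ->
  (forall f z, F f -> 0 <= g f z) -> (forall f, F f -> 0 <= q f) ->
  (forall e : R, 0 < e -> exists (cen : nat -> T) (rad : nat -> R),
    (forall f j z, F f -> dist z (cen j) < rad j -> `|g f z - g f (cen j)| <=
      e) /\
    (forall z, exists j, dist z (cen j) < rad j)) ->
  measurable_fun setT (fun t : N.-tuple T =>
    inf [set r | exists2 f, F f & r = empirical_mean t (g f) + q f]).
Proof.
move=> menlarge N0 F0 g0 q0 osc; apply: measurable_fun_osc => e e0.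
have N0R : 0 < N%:R :> R by rewrite ltr0n.
have e20 : 0 < e / 2 by lra.
have [cen [rad [oscP cover]]] := osc _ e20.
exists (fun j => [set z | dist z (cen j) < rad j]); split => // [j|t t' tt'].
  rewrite [X in measurable X](_ : _ = enlarge dist [set cen j] (rad j)) //.
  by apply/seteqP; split => [x xr|x [_ ->]//]; exists (cen j).
rewrite -lerBlDl; apply: le_trans (ler_norm _) _.
apply: (@ler_dist_inf _ _ _ (fun f => empirical_mean t' (g f) + q f)
  (fun f => empirical_mean t (g f) + q f) _ 0) => // f Ff; last first.
  by rewrite addr_ge0 ?q0 // mulr_ge0 ?invr_ge0 // sumr_ge0 // => i _;
    exact: g0.
rewrite opprD addrACA subrr addr0 -mulrBr -sumrB normrM ger0_norm ?invr_ge0 //.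
rewrite ler_pdivrMl // mulr_natl -[N in leRHS]card_ord -sumr_const.
apply: le_trans (ler_norm_sum _ _ _) _; apply: ler_sum => i _.
have [j tj t'j] := tt' i; have := oscP f j _ Ff tj; have := oscP f j _ Ff t'j.
set a := g f _; set b := g f (cen j); set a' := g f _ => h1 h2.
have -> : a - a' = (a - b) - (a' - b) by ring.
by apply: le_trans (ler_normB _ _) _; lra.
Qed.

Theorem theorem4p1
  (R : realType) (E : normedModType R) (X : set E) (Y : set R) (z0 : X * Y)
  (nrm : E * R^o -> R) (nrmP : product_norm nrm)
  (polishZ : polish (@embed_dist R E X Y nrm))
  (k : X -> X -> R) (kP : kernel_psd k) (H : rkhs k)
  (F : set (X -> Y)) (F_neq0 : F !=set0)
  (F_sub : forall f, F f -> rkhs_set H (fun x => \val (f x)))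
  (c : (X * Y) * Y -> R)
  (c_ge0 : forall (z : X * Y) f, F f -> 0 <= c (z, f z.1))
  (Ka : forall Z0 : set (X * Y), compact Z0 -> forall e : R, 0 < e ->
    exists2 eta : R, 0 < eta & forall x x' : X,
      (fst @` Z0) x -> (fst @` Z0) x' -> `|\val x' - \val x| < eta ->
      rkhs_norm H (k^~ x' \- k^~ x) < e)
  (beta : R) (beta_gt0 : 0 < beta)
  (Kb : forall f, F f -> rkhs_norm H (fun x => \val (f x)) <= beta)
  (phi : X * Y -> R) (phi_gauge : gauge_function phi)
  (Ca_le : forall (z : X * Y) f, F f -> c (z, f z.1) <= phi z)
  (Ca_infty : forall a : R, exists r : R, forall z : X * Y,
    r < nrm (embed z) -> a < phi z)
  (Cb : continuous c)
  (kappa p : R) (kappa_ge0 : 0 <= kappa) (p_gt1 : 1 < p)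
  (M : set (probability (borel_space z0) R))
  (M_sub : forall P, M P -> (\int[P]_z (phi z `^ p)%:E <= kappa%:E)%E)
  (lam : nat -> R) (lam_gt0 : forall N, (0 < N)%N -> 0 < lam N)
  (lam_cvg0 : lam @ \oo --> (0 : R)) :
  let law := fun (P : probability (borel_space z0) R) (N : nat) =>
    pushforward (power_probability P N) (reg_risk H F c (lam N)) in
  forall P, M P -> forall e : R, 0 < e ->
  exists (delta : R) (N0 : nat), 0 < delta /\
    forall Q, M Q -> phi_dist (T := borel_space z0) (embed_dist nrm) phi P Q <= delta ->
    forall N : nat, (N0 <= N)%N -> lam N <= e / (6 * beta ^+ 2) ->
    prokhorov (fun x y : R => `|x - y|) (law P N) (law Q N) <= e.
Proof.
move=> law P MP e e0.
pose dist : borel_space z0 -> borel_space z0 -> R := embed_dist nrm.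
have open_meas (A : set (borel_space z0)) : open A -> measurable A.
  exact: sub_sigma_algebra.
have menlarge A r : measurable (enlarge dist A r).
  by apply: open_meas; exact: open_enlarge.
pose g (f : X -> Y) (z : borel_space z0) := c (z, f z.1).
have mphi : measurable_fun [set: borel_space z0] phi.
  apply: measurable_fun_lt => r; apply: open_meas.
  have [cphi _ _] := phi_gauge.
  rewrite [X in open X](_ : _ = phi @^-1` [set x | x < r]) //.
  by apply: open_comp; [move=> x _; exact: cphi|exact: open_lt].
have g0 f z : F f -> 0 <= g f z by exact: c_ge0.
have gphi f z : F f -> g f z <= phi z by exact: Ca_le.
have osc (r : R) : 0 < r -> exists (cen : nat -> borel_space z0) (rad : nat ->
  R),
    (forall f j z, F f -> dist z (cen j) < rad j -> `|g f z - g f (cen j)| <=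
      r) /\
    (forall z, exists j, dist z (cen j) < rad j).
  move=> r0; have r20 : 0 < r / 2 by lra.
  pose good (a : X * Y) s := forall f z, F f -> embed_dist nrm z a < s -> `|c
    (z, f z.1) - c (a, f a.1)| <= r.
  have [z|cen [rad [h1 h2]]] := separable_ball_cover z0 nrmP polishZ (good :=
    good).
    have [s s0 sP] := cost_equicontinuous z0 nrmP polishZ Ka F_sub Kb Cb z r20.
    exists s => // a s' s'0 as' f z' Ff z'a.
    have az : embed_dist nrm a z < s by apply: lt_le_trans as'; rewrite ltrDl.
    have z'z : embed_dist nrm z' z < s.
      by apply: le_lt_trans (embed_distD nrmP a z' z) _; lra.
    have := sP f a Ff az; have := sP f z' Ff z'z.
    set u := c (z', _); set v := c (a, _); set w := c (z, _) => k1 k2.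
    have -> : u - v = (u - w) - (v - w) by ring.
    by apply: le_trans (ler_normB _ _) _; lra.
  (* A ball that contains a point has positive radius, hence is good. *)
  exists cen, rad; split => // f j z Ff zj; apply: (h1 j) => //.
  apply: le_lt_trans zj; exact: (product_norm_ge0 nrmP).
have e24 : 0 < e / 24 by lra.
have [cen [rad [oscP cover]]] := osc _ e24.
have [theta [delta [N0 [delta0 conc]]]] :=
  concentration menlarge (@embed_distC _ _ _ nrmP X Y) (@embed_distD _ _ _ nrmP
    X Y) F_neq0 g0 gphi mphi P p_gt1 kappa_ge0 e0 oscP cover.
(* The successor gives the strict inequality that [conc] asks for, and makes [N] positive as in
   [lam_gt0]. *)
exists delta, N0.+1; split => // Q MQ PQ N N0N lamN.
have N_gt0 : (0 < N)%N by exact: leq_ltn_trans N0N.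
pose q (f : X -> Y) := lam N * rkhs_norm H (fun x => \val (f x)) ^+ 2.
have q0 f : 0 <= q f by rewrite mulr_ge0 ?sqr_ge0 // ltW // lam_gt0.
(* The threshold on [lam N] and [Kb] enter here: [beta ^+ 2] cancels. *)
have q6 f : F f -> 0 <= q f <= e / 6.
  move=> Ff; rewrite q0 /=.
  have b2 : 0 < beta ^+ 2 by rewrite exprn_gt0.
  apply: (@le_trans _ _ (e / (6 * beta ^+ 2) * beta ^+ 2)).
    apply: ler_pM => //; rewrite ?sqr_ge0 //; first by rewrite ltW // lam_gt0.
    by rewrite lerXn2r ?nnegrE ?rkhs_norm_ge0 ?(ltW beta_gt0) // Kb.
  by rewrite le_eqVlt; apply/orP; left; apply/eqP; field; rewrite gt_eqF.
have mrisk : measurable_fun [set: N.-tuple (borel_space z0)] (reg_risk H F c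
  (lam N)).
  by apply: (@measurable_fun_regularized_inf _ (borel_space z0) _ dist _ F g q
    N).
have PP : prokhorov dist P P <= delta.
  by apply: prokhorov_xx => // x; exact: embed_distxx.
have PQ' : prokhorov dist P Q <= delta.
  by apply: le_trans PQ; rewrite /phi_dist lerDl.
(* The two uses of [conc], at [P] and at [Q], share the centre [theta]. *)
have [W1 [mW1 PW1] W1P] := conc P (M_sub _ MP) PP N N0N.
have [W2 [mW2 PW2] W2P] := conc Q (M_sub _ MQ) PQ' N N0N.
apply: (le_prokhorov_pushforward (theta := theta) e0 mrisk mrisk mW1 mW2 PW1
  PW2).
  exact: (W1P q q6).
exact: (W2P q q6).
Qed.
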